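(* For each of the following graph families, any one-round distributed interactive proof deciding membership in the family with completeness and soundness errors smaller than $1/10$ requires proof size $\Omega(\log n)$: (1) path-outerplanar graphs; (2) outerplanar graphs; (3) embedded planar graphs (the planar embedding task); (4) planar graphs; (5) series-parallel graphs; (6) graphs of treewidth at most $2$.
   Context: A one-round distributed interactive proof on an $n$-node connected graph $G=(V,E)$ (possibly with local node inputs): a centralized prover, seeing the whole instance, assigns each node $v$ a bit string (label); then each node, possibly using randomness, outputs yes/no as a function of its local input, its randomness, its label and the labels of its neighbors. The verifier accepts iff all nodes output yes. Completeness error $\epsilon_c$: for every yes-instance some label assignment makes the verifier accept with probability at least $1-\epsilon_c$; soundness error $\epsilon_s$: for every no-instance and every label assignment the verifier rejects with probability at least $1-\epsilon_s$. The proof size is the maximum label length of the honest (yes-instance) assignment. A graph is path-outerplanar if it has a Hamiltonian path $P$ such that, writing $u\prec v$ if $u$ precedes $v$ on $P$, no two edges $(u,v),(u',v')$ satisfy $u\prec u'\prec v\prec v'$. In the planar embedding task, each node $v$ receives as input a bijection $\rho_v:E(v)\to\{0,\dots,\deg(v)-1\}$ giving a clockwise ordering of its incident edges, and the yes-instances are those where $\{\rho_v\}_v$ induces a combinatorial planar embedding (a crossing-free plane drawing of $G$ whose clockwise edge order around each $v$ agrees with $\rho_v$). Series-parallel graphs and treewidth have their standard meanings. *)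

(* Defs.v *)
From HB Require Import structures.
From mathcomp Require Import all_boot all_order all_algebra.
From mathcomp Require Import all_classical all_reals all_analysis.
Import Order.TTheory GRing.Theory Num.Theory.
Import numFieldNormedType.Exports.

Set Implicit Arguments.
Unset Strict Implicit.
Unset Printing Implicit Defensive.

Local Open Scope classical_set_scope.
Local Open Scope ring_scope.

Record graph (V : finType) := Graph {
  adj :> rel V;
  adj_sym : symmetric adj;
  adj_irr : irreflexive adj }.

Definition edges (V : finType) (G : graph V) : {set {set V}} :=
  [set [set p.1; p.2] | p : V * V & G p.1 p.2]%SET.

Definition connected_graph (V : finType) (G : graph V) : Prop :=
  forall u v, connect G u v.

Definition path_outerplanar (V : finType) (G : graph V) : Prop :=
  exists P : seq V,
    [/\ uniq P, forall v, v \in P, sorted G P &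
        forall u v u' v', G u v -> G u' v' ->
          ~ [/\ (index u P < index u' P)%N, (index u' P < index v P)%N &
                (index v P < index v' P)%N]].

(* Two-terminal series-parallel graphs, as sub-objects [(U, E)] (vertices and
   edges) of one ambient vertex type, with terminals [s] and [t]. Requiring
   disjoint edge sets in a parallel composition loses nothing: a parallel pair
   of edges would survive to the end, and the final graph is simple. *)
Inductive sp_graph (V : finType) : {set V} -> {set {set V}} -> V -> V -> Prop :=
| SpEdge s t : s != t -> sp_graph [set s; t]%SET [set [set s; t]]%SET s t
| SpSeries (U1 U2 : {set V}) (E1 E2 : {set {set V}}) s m t :
    sp_graph U1 E1 s m -> sp_graph U2 E2 m t -> (U1 :&: U2)%SET = [set m]%SET ->
    sp_graph (U1 :|: U2)%SET (E1 :|: E2)%SET s t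
| SpParallel (U1 U2 : {set V}) (E1 E2 : {set {set V}}) s t :
    sp_graph U1 E1 s t -> sp_graph U2 E2 s t ->
    (U1 :&: U2)%SET = [set s; t]%SET -> (E1 :&: E2)%SET = finset.set0 ->
    sp_graph (U1 :|: U2)%SET (E1 :|: E2)%SET s t.

Definition series_parallel (V : finType) (G : graph V) : Prop :=
  exists s t, sp_graph [set: V]%SET (edges G) s t.

(* [ucycle] also accepts sequences of at most two vertices. *)
Definition is_tree (T : finType) (G : graph T) : Prop :=
  connected_graph G /\ forall c : seq T, ucycle G c -> (size c <= 2)%N.

Definition tree_decomposition (V T : finType) (G : graph V) (F : graph T)
    (B : T -> {set V}) : Prop :=
  [/\ is_tree F,
      forall v, exists t, v \in B t,
      forall u v, G u v -> exists t, (u \in B t) && (v \in B t) &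
      forall v t t', v \in B t -> v \in B t' ->
        connect [rel x y | [&& F x y, v \in B x & v \in B y]] t t'].

Definition treewidth_le (V : finType) (G : graph V) (k : nat) : Prop :=
  exists (T : finType) (F : graph T) (B : T -> {set V}),
    tree_decomposition G F B /\ forall t, (#|B t| <= k.+1)%N.

Section PlaneDrawings.
Variable R : realType.

Definition segment (a b : R * R) : set (R * R) :=
  [set x | exists2 t : R, 0 <= t <= 1 & x = (1 - t) *: a + t *: b].

Definition polyline (s : seq (R * R)) : set (R * R) :=
  [set x | exists2 i : nat, (i.+1 < size s)%N & segment s`_i s`_i.+1 x].

Definition simple_polyline (s : seq (R * R)) : Prop :=
  (forall i : nat, (i.+1 < size s)%N -> s`_i != s`_i.+1) /\
  (forall (i j : nat) x, (i < j)%N -> (j.+1 < size s)%N ->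
     segment s`_i s`_i.+1 x -> segment s`_j s`_j.+1 x ->
     j = i.+1 /\ x = s`_j).

Variables (V : finType) (G : graph V).

(* As usual in graph theory, the arcs of a plane drawing are polygonal; this
   also gives each edge a well-defined direction at each of its ends. *)
Record drawing := Drawing {
  pos : V -> R * R;
  bends : V -> V -> seq (R * R) }.

Definition edge_arc (D : drawing) (u v : V) : seq (R * R) :=
  pos D u :: rcons (bends D u v) (pos D v).

Definition crossing_free (D : drawing) : Prop :=
  [/\ injective (pos D),
      forall u v, G u v ->
        simple_polyline (edge_arc D u v) /\ bends D v u = rev (bends D u v),
      forall u v w, G u v -> polyline (edge_arc D u v) (pos D w) -> w = u \/ w = v &
      forall u v u' v' x, G u v -> G u' v' ->
        [set u; v]%SET != [set u'; v']%SET ->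
        polyline (edge_arc D u v) x -> polyline (edge_arc D u' v') x ->
        exists2 w, w \in ([set u; v] :&: [set u'; v'])%SET & x = pos D w].

Definition planar : Prop := exists D, crossing_free D.

Definition drawn (D : drawing) : set (R * R) :=
  [set x | (exists v, x = pos D v) \/
           (exists u v, G u v /\ polyline (edge_arc D u v) x)].

Definition face_of (D : drawing) (x : R * R) : set (R * R) :=
  connected_component (~` drawn D) x.

Definition outerplanar : Prop :=
  exists D, crossing_free D /\
    exists x, [/\ (~` drawn D) x, ~ bounded_set (face_of D x) &
                  forall v, closure (face_of D x) (pos D v)].

Definition direction (D : drawing) (v u : V) : R * R :=
  (edge_arc D v u)`_1 - pos D v.

(* [ns] lists the neighbours of [v]; turning clockwise through their edges,
   in this order, takes less than one full turn. *)
Definition clockwise_at (D : drawing) (v : V) (ns : seq V) : Prop :=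
  exists theta : nat -> R,
    [/\ forall i j : nat, (i < j)%N -> (j < size ns)%N -> theta j < theta i,
        forall i : nat, (i < size ns)%N -> theta 0%N - pi *+ 2 < theta i &
        forall i : nat, (i < size ns)%N ->
          exists2 r : R, 0 < r &
            direction D v (nth v ns i) = (r * cos (theta i), r * sin (theta i))].

(* [rho v] lists the neighbours of [v]: the edge [uv] has index
   [index u (rho v)] in the ordering at [v]. *)
Definition planar_embedding (rho : V -> seq V) : Prop :=
  exists D, crossing_free D /\ forall v, clockwise_at D v (rho v).

End PlaneDrawings.

(* The local input of a node [v] is a bijection from its incident edges to
   {0, ..., deg v - 1}, given by listing the neighbours of [v]. It is the
   clockwise ordering in the planar embedding task, and an arbitrary port
   numbering for the pure graph families. *)
Record instance (n : nat) := Instance {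
  inst_graph : graph 'I_n;
  inst_ports : 'I_n -> seq 'I_n;
  inst_connected : connected_graph inst_graph;
  inst_ports_uniq : forall v, uniq (inst_ports v);
  inst_ports_mem : forall v, inst_ports v =i inst_graph v }.

Definition task := forall n : nat, instance n -> Prop.

Definition label := seq bool.

(* Node [v] decides from its own label, the labels of its neighbours listed by
   port (so that its degree is known too), and its private random source. The
   joint law of the [n] sources is the [n]-fold power of the law of one. *)
Record verifier (R : realType) (n : nat) := Verifier {
  coin_display : measure_display;
  coin_type : measurableType coin_display;
  coin_law : probability coin_type R;
  coins_law : probability (n.-tuple coin_type) R;
  coins_independent : forall A : 'I_n -> set coin_type,
    (forall v, measurable (A v)) ->
    coins_law [set w | forall v, A v (tnth w v)] =
      (\prod_(v < n) coin_law (A v))%E;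
  verdict : label -> seq label -> coin_type -> bool;
  verdict_measurable : forall l ls, measurable [set w | verdict l ls w] }.

Definition accepts (R : realType) (n : nat) (A : verifier R n) (I : instance n)
    (l : 'I_n -> label) (w : n.-tuple (coin_type A)) : Prop :=
  forall v, verdict (l v) [seq l u | u <- inst_ports I v] (tnth w v).

Definition complete (R : realType) (n : nat) (F : task) (A : verifier R n)
    (honest : instance n -> 'I_n -> label) (eps : R) : Prop :=
  forall I, F n I ->
    ((1 - eps)%:E <= coins_law A [set w | accepts I (honest I) w])%E.

Definition sound (R : realType) (n : nat) (F : task) (A : verifier R n)
    (eps : R) : Prop :=
  forall I, ~ F n I -> forall l : 'I_n -> label,
    ((1 - eps)%:E <= coins_law A [set w | ~ accepts I l w])%E.

Definition proof_size_le (n : nat) (F : task)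
    (honest : instance n -> 'I_n -> label) (s : nat) : Prop :=
  forall I, F n I -> forall v, (size (honest I v) <= s)%N.

Definition requires_log_proof_size (R : realType) (F : task) : Prop :=
  exists (c : R) (n0 : nat), 0 < c /\
    forall (n : nat), (n0 <= n)%N ->
    forall (A : verifier R n) (honest : instance n -> 'I_n -> label)
           (eps_c eps_s : R),
      0 <= eps_c < 10^-1 -> 0 <= eps_s < 10^-1 ->
      complete F A honest eps_c -> sound F A eps_s ->
      forall s : nat, proof_size_le F honest s -> c * ln n%:R <= s%:R.

Definition path_outerplanar_task : task :=
  fun n I => path_outerplanar (inst_graph I).

Definition outerplanar_task (R : realType) : task :=
  fun n I => outerplanar R (inst_graph I).

Definition planar_embedding_task (R : realType) : task :=
  fun n I => planar_embedding R (inst_graph I) (inst_ports I).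

Definition planar_task (R : realType) : task :=
  fun n I => planar R (inst_graph I).

Definition series_parallel_task : task :=
  fun n I => series_parallel (inst_graph I).

Definition treewidth2_task : task :=
  fun n I => treewidth_le (inst_graph I) 2.

(* Main.v *)
(* A node sees only its own label and those of its neighbours, so exchanging
   the far ends of two edges ab, cd with equally labelled ends (a like c, b
   like d) leaves the acceptance event unchanged. With labels of o(log n) bits
   two such edges exist among any linear number of candidates. It remains to
   find yes-instances that such an exchange turns into no-instances.

   Planarity: in a ladder whose rungs are nested along a Hamiltonian path,
   exchanging two rungs produces a subdivision of K_{3,3}. That K_{3,3} has no
   polygonal plane drawing is shown by van Kampen's parity argument: for
   disjoint edges e, f the difference map x - y on e * f avoids the origin, so
   counting mod 2 the crossings of a ray along the boundary of e * f gives one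
   equation per pair of disjoint edges, and these equations sum to 0 = 1. The
   ladder itself is drawn with its vertices on a parabola.

   Series-parallel graphs and treewidth 2: exchanging two edges of the path of
   a fan splits off a cycle, which together with the hub is a subgraph of
   minimum degree 3. *)

Require Import Defs.
From mathcomp Require Import all_boot all_order all_fingroup all_algebra.
From mathcomp Require Import all_classical all_reals all_analysis.
From mathcomp Require Import zify ring lra.
Import Order.TTheory GRing.Theory Num.Theory.
Import numFieldNormedType.Exports.

Set Implicit Arguments.
Unset Strict Implicit.
Unset Printing Implicit Defensive.

Local Open Scope classical_set_scope.
Local Open Scope ring_scope.

(** * Padded labels and the pigeonhole principle *)

Definition pad_label (s : nat) (l : label) : s.+1.-tuple bool :=
  insubd (nseq_tuple s.+1 false) (l ++ true :: nseq (s - size l) false).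

(** A [true] closes the label before the padding by [false], so the label can be read off from the
    back; labels of at most [s] bits become words of exactly [s.+1] bits. *)
Lemma pad_label_inj (s : nat) (l l' : label) :
  (size l <= s)%N -> (size l' <= s)%N -> pad_label s l = pad_label s l' -> l = l'.
Proof.
move=> ls l's /(congr1 val); rewrite /pad_label !val_insubd.
have szE (k : label) : (size k <= s)%N ->
    size (k ++ true :: nseq (s - size k) false) == s.+1.
  by move=> ks; rewrite size_cat /= size_nseq; lia.
rewrite !szE // => /(congr1 rev); rewrite !rev_cat !rev_cons !rev_nseq.
rewrite !cat_rcons; move: (s - size l)%N (s - size l')%N => a b.
elim: a b => [|a IHa] [|b] //= []; last exact: IHa.
exact: (can_inj revK).
Qed.

(** Pigeonhole on the pairs of padded end labels, of which there are 2 ^ (s.+1 + s.+1). *)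
Lemma equally_labelled_pair (m n s : nat) (x y : 'I_m -> 'I_n)
    (l : 'I_n -> label) :
  (forall v, size (l v) <= s)%N -> (2 ^ (s.+1 + s.+1) < m)%N ->
  exists i j : 'I_m, [/\ (i < j)%N, l (x i) = l (x j) & l (y i) = l (y j)].
Proof.
move=> ls ltm; pose f i := (pad_label s (l (x i)), pad_label s (l (y i))).
have /injectivePn [i [j ij fij]] : ~~ injectiveb f.
  apply/injectiveP => /leq_card; rewrite card_ord card_prod !card_tuple card_bool.
  by rewrite -expnD leqNgt ltm.
clear ltm.
have [/(pad_label_inj (ls _) (ls _)) lx /(pad_label_inj (ls _) (ls _)) ly] :
  pad_label s (l (x i)) = pad_label s (l (x j)) /\
  pad_label s (l (y i)) = pad_label s (l (y j)) by case: fij.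
case: (ltngtP i j) => [ltij|ltji|/val_inj eqij].
- by exists i, j; rewrite ltij lx ly.
- by exists j, i; rewrite ltji lx ly.
- by rewrite eqij eqxx in ij.
Qed.

(** * From indistinguishable instances to a logarithmic bound *)

Lemma measurable_accepts (R : realType) (n : nat) (A : verifier R n)
    (I : instance n) (l : 'I_n -> label) :
  measurable [set w | accepts (A := A) I l w].
Proof.
pose B v := [set c | @verdict R n A (l v) [seq l u | u <- inst_ports I v] c].
have -> : [set w | accepts (A := A) I l w] =
    \bigcap_(v in [set: 'I_n]) ((@tnth n _)^~ v @^-1` B v).
  by apply/seteqP; split => w /= H v; [move=> _; exact: H | exact: (H v Logic.I)].
apply: fin_bigcap_measurable => [|v _].
  exact: finite_finset.
rewrite -[X in measurable X]setTI; apply: (measurable_tnth v) => //.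
exact: verdict_measurable.
Qed.

Lemma ln2_le1 (R : realType) : ln 2 <= 1 :> R.
Proof.
by rewrite -ler_expR lnK ?posrE //; exact: expR_ge1Dx.
Qed.

Lemma ln_le_label_size (R : realType) (n s : nat) :
  (60 < n)%N -> (n %/ 12 <= 2 ^ (s.+1 + s.+1))%N ->
  8^-1 * ln n%:R <= s%:R :> R.
Proof.
move=> n60 le_n.
(* For [s = 0] the hypothesis would read n %/ 12 <= 4, but n > 60 gives at least 5. *)
have s_gt0 : (0 < s)%N.
  rewrite lt0n; apply/eqP => s0; move: le_n; rewrite s0 leqNgt.
  by rewrite (leq_trans (isT : (2 ^ (1 + 1) < 5)%N)) // leq_divRL // ltnW.
have le_n2 : (n <= 2 ^ (8 * s))%N.
  have n_lt : (n < (2 ^ (s.+1 + s.+1)).+1 * 12)%N.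
    by rewrite -ltn_divLR.
  (* Both factors of the split power are at least 16, which absorbs the 12 in n < 12 (2 ^ (s.+1 +
     s.+1) + 1). *)
  have -> : (8 * s = (s.+1 + s.+1) + (6 * s - 2))%N by lia.
  have : (2 ^ 4 <= 2 ^ (s.+1 + s.+1))%N by rewrite leq_exp2l //; lia.
  have : (2 ^ 4 <= 2 ^ (6 * s - 2))%N by rewrite leq_exp2l //; lia.
  rewrite (expnD _ (s.+1 + s.+1)%N).
  move: (2 ^ (6 * s - 2))%N (2 ^ (s.+1 + s.+1))%N n_lt => p q n_lt p16 q16.
  have : (q * 2 ^ 4 <= q * p)%N by rewrite leq_mul2l p16 orbT.
  rewrite (_ : 2 ^ 4 = 16)%N // in p16 q16 *; lia.
have : ln n%:R <= ln (2 ^+ (8 * s)) :> R.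
  rewrite ler_ln ?posrE ?exprn_gt0 ?ltr0n //; last by apply: leq_trans n60.
  by rewrite -natrX ler_nat.
rewrite lnXn // -[ln 2 *+ _]mulr_natl natrM.
have : 0 <= s%:R * (1 - ln 2) :> R.
  by rewrite mulr_ge0 // subr_ge0 ln2_le1.
lra.
Qed.

(** Short labels would yield two equally labelled candidates. Replaying the honest labels of [I] on
    [J] then gives every node the same view, so one event would have probability above 9/10 by
    completeness, and its complement too by soundness. *)
Lemma crossing_lower_bound (R : realType) (F : task) :
  (forall n, (60 < n)%N -> exists (I : instance n) (x y : 'I_(n %/ 12) -> 'I_n),
     F n I /\ forall i j : 'I_(n %/ 12), (i < j)%N -> exists J : instance n, ~ F n J /\
       forall l : 'I_n -> label, l (x i) = l (x j) -> l (y i) = l (y j) ->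
       forall v, [seq l u | u <- inst_ports J v] = [seq l u | u <- inst_ports I v]) ->
  requires_log_proof_size R F.
Proof.
move=> crossing; exists 8^-1, 61%N; split; first by rewrite invr_gt0.
move=> n n60 A honest ec es /andP[_ ec1] /andP[_ es1] compl snd s ls.
have [I [x [y [FI cross]]]] := crossing n n60.
apply: ln_le_label_size => //; rewrite leqNgt; apply/negP => ltm.
have [i [j [ij lx ly]]] := equally_labelled_pair x y (ls I FI) ltm.
have [J [FJ views]] := cross i j ij.
have sameE : [set w | accepts (A := A) J (honest I) w] =
             [set w | accepts (A := A) I (honest I) w].
  by apply/seteqP; split => w /= acc v; have := acc v; rewrite views.
have := snd J FJ (honest I); have := compl I FI; rewrite -sameE.
have mS := @measurable_accepts R n A J (honest I).
rewrite -[[set w | ~ _]]/(~` [set w | accepts (A := A) J (honest I) w]).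
rewrite probability_setC //.
have := fin_num_measure (coins_law A) _ mS.
move: (coins_law A _) => p; case: p => [p||] // _.
rewrite -EFinB !lee_fin; lra.
Qed.

(** * Exchanging the far ends of two edges *)

Section Swap.
Variables (V : finType) (a b c d : V).

(** The exchange is a renaming of neighbours at each node, so that adjacency and port lists change
    by the same map and each renamed neighbour keeps its port. *)
Definition swap_nbr (v : V) : V -> V :=
  if v \in [:: a; c] then (tperm b d : V -> V)
  else if v \in [:: b; d] then (tperm a c : V -> V) else id.

Lemma swap_nbrK v : involutive (swap_nbr v).
Proof.
move=> y; rewrite /swap_nbr; case: (v \in _); first exact: tpermK.
by case: (v \in _); first exact: tpermK.
Qed.

Variable G : graph V.
Hypotheses (uniq_abcd : uniq [:: a; b; c; d])
  (Gab : G a b) (Gcd : G c d) (nGad : ~~ G a d) (nGcb : ~~ G c b).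

Definition swap_adj : rel V := [rel x y | G x (swap_nbr x y)].

(** Both ends must agree on the exchanged pairs. The pair [a b] vanishes seen from [a] because [a d]
    was no edge, and seen from [b] because [c b] was none; the pair [a d] appears at [a] because of
    [a b] and at [d] because of [c d]. *)
Lemma swap_adj_sym : symmetric swap_adj.
Proof.
move=> x y; rewrite /swap_adj /= /swap_nbr !inE.
move: uniq_abcd; rewrite /= !inE !negb_or.
case/and4P=> /and3P[ab ac ad] /andP[bc bd] cd _.
have [Gba Gdc] : G b a /\ G d c by rewrite !(adj_sym G b a) !(adj_sym G d c).
have [nGda nGbc] : G d a = false /\ G b c = false.
  by rewrite (adj_sym G d a) (adj_sym G b c) (negPf nGad) (negPf nGcb).
have sym := adj_sym G.
have [-> {x}|xa] := eqVneq x a; rewrite /=.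
  case: tpermP => [->|->|/eqP yb /eqP yd].
  - by rewrite (negPf nGad) [b == a]eq_sym (negPf ab) (negPf bc) eqxx /= tpermL nGbc.
  - by rewrite Gab [d == a]eq_sym (negPf ad) [d == c]eq_sym (negPf cd) eqxx orbT /= tpermL.
  rewrite (negPf yb) (negPf yd); by case: ifP => _; rewrite /= ?tpermD ?(sym _ y) // 1?eq_sym.
have [-> {x xa}|xc] := eqVneq x c; rewrite /=.
  case: tpermP => [->|->|/eqP yb /eqP yd].
  - by rewrite Gcd [b == a]eq_sym (negPf ab) (negPf bc) eqxx /= tpermR Gba.
  - rewrite (negPf nGcb) [d == a]eq_sym (negPf ad) [d == c]eq_sym (negPf cd).
    by rewrite eqxx orbT /= tpermR nGda.
  rewrite (negPf yb) (negPf yd); by case: ifP => _; rewrite /= ?tpermD ?(sym _ y) // 1?eq_sym.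
have [xbd|xbd] := boolP ((x == b) || (x == d)); last first.
  move: xbd; rewrite negb_or => /andP[xb xd].
  by do 2 (case: ifP => _; rewrite ?tpermD // 1?eq_sym //).
case: tpermP => [->|->|/eqP ya /eqP yc].
- rewrite eqxx /=; case/orP: xbd => /eqP ->.
    by rewrite tpermL nGbc (negPf nGad).
  by rewrite tpermR Gdc Gab.
- rewrite eqxx orbT /=; case/orP: xbd => /eqP ->.
    by rewrite tpermL Gba Gcd.
  by rewrite tpermR nGda (negPf nGcb).
rewrite (negPf ya) (negPf yc) /=; case: ifP => _ //.
by rewrite tpermD // 1?eq_sym.
Qed.

Lemma swap_adj_irr : irreflexive swap_adj.
Proof.
move=> x; rewrite /swap_adj /= /swap_nbr !inE.
move: uniq_abcd; rewrite /= !inE !negb_or.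
case/and4P=> /and3P[ab ac ad] /andP[bc bd] cd _.
have irr := adj_irr G.
case: ifP => [/orP[]/eqP->|_]; first by rewrite tpermD 1?eq_sym.
  by rewrite tpermD // eq_sym.
case: ifP => [/orP[]/eqP->|_]; last exact: irr.
  by rewrite tpermD // eq_sym.
by rewrite tpermD // eq_sym.
Qed.

Definition swap_graph : graph V := Graph swap_adj_sym swap_adj_irr.

Lemma swap_graph_ad : swap_graph a d.
Proof. by rewrite /= /swap_adj /= /swap_nbr inE eqxx /= tpermR. Qed.

Lemma swap_graph_cb : swap_graph c b.
Proof. by rewrite /= /swap_adj /= /swap_nbr !inE eqxx orbT /= tpermL. Qed.

Lemma swap_graph_kept x y : G x y ->
  ~~ ((x \in [:: a; c]) && (y \in [:: b; d])) ->
  ~~ ((x \in [:: b; d]) && (y \in [:: a; c])) -> swap_graph x y.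
Proof.
rewrite /= /swap_adj /= /swap_nbr => Gxy.
case: ifP => [xac /= ybd _|_ _].
  by move: ybd; rewrite !inE negb_or => /andP[yb yd]; rewrite tpermD // eq_sym.
case: ifP => [xbd /= yac|_ //].
by move: yac; rewrite !inE negb_or => /andP[ya yc]; rewrite tpermD // eq_sym.
Qed.

Lemma map_swap_nbr (T : eqType) (l : V -> T) v (s : seq V) :
  l a = l c -> l b = l d -> [seq l u | u <- map (swap_nbr v) s] = map l s.
Proof.
move=> lac lbd; rewrite -map_comp; apply: eq_map => u /=; rewrite /swap_nbr.
case: ifP => _; first by case: tpermP => [->|->|_ _].
by case: ifP => _ //; case: tpermP => [->|->|_ _].
Qed.

End Swap.

Section SwapInstance.
Variables (n : nat) (I : instance n) (a b c d : 'I_n).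
Hypotheses (uniq_abcd : uniq [:: a; b; c; d])
  (Gab : inst_graph I a b) (Gcd : inst_graph I c d)
  (nGad : ~~ inst_graph I a d) (nGcb : ~~ inst_graph I c b).

Let G' := swap_graph uniq_abcd Gab Gcd nGad nGcb.
Let ports v := map (swap_nbr a b c d v) (inst_ports I v).

Lemma swap_ports_uniq v : uniq (ports v).
Proof.
rewrite /ports map_inj_uniq ?inst_ports_uniq //.
exact: can_inj (@swap_nbrK _ a b c d v).
Qed.

Lemma swap_ports_mem v : ports v =i G' v.
Proof.
move=> u; rewrite /ports -{1}(@swap_nbrK _ a b c d v u) mem_map ?inst_ports_mem //.
exact: can_inj (@swap_nbrK _ a b c d v).
Qed.

Definition swap_instance (conn : connected_graph G') : instance n :=
  Instance conn swap_ports_uniq swap_ports_mem.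

End SwapInstance.

(** * Parity of ray crossings in the plane *)

Section RayParity.
Variable R : realType.
Implicit Types z w p q x : R * R.

(** The boundary axis is split so that exactly one of [z] and [- z] is counted for every nonzero
    [z]. *)
Definition upper z : bool := (0 < z.2) || (z.2 == 0) && (0 < z.1).

Definition crossp z w : R := z.1 * w.2 - z.2 * w.1.

(* Whether the segment from [z] to [w] crosses the positive first axis; the
   values are meaningful only when the segment avoids the origin. *)
Definition ray z w : bool :=
  [&& upper z, ~~ upper w & crossp z w < 0] ||
  [&& ~~ upper z, upper w & 0 < crossp z w].

Lemma upperN z : z != 0 -> upper (- z) = ~~ upper z.
Proof.
case: z => x y; rewrite /upper /= oppr_gt0 oppr_eq0 oppr_gt0 => nz.
have [y0|y0|y0] := ltgtP y 0; rewrite //=.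
have [//|//|x0] := ltgtP x 0.
by rewrite x0 y0 eqxx in nz.
Qed.

(* A convex cone missing the origin meets only one half of the first axis. *)
Lemma ray_cone (K : set (R * R)) :
  (forall a b z w, 0 <= a -> 0 <= b -> 0 < a + b -> K z -> K w ->
     K (a * z.1 + b * w.1, a * z.2 + b * w.2)) ->
  ~ K (0, 0) ->
  exists b : bool, forall z w, K z -> K w ->
    ray z w = b && (upper z (+) upper w).
Proof.
move=> Kc K0.
have Kc' (v : R * R) a b z w : K z -> K w -> 0 <= a -> 0 <= b -> 0 < a + b ->
    v.1 = a * z.1 + b * w.1 -> v.2 = a * z.2 + b * w.2 -> K v.
  move=> Kz Kw a0 b0 ab v1 v2; rewrite [v]surjective_pairing v1 v2.
  exact: Kc.
(* The combination with coefficients [- w.2] and [z.2] lies on the first axis; if both vanish, the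
   origin lies between [z] and [w]. *)
have axis z w : K z -> K w -> upper z -> ~~ upper w -> K (- crossp z w, 0).
  move=> Kz Kw; rewrite /upper negb_or negb_and -!leNgt /crossp.
  have [z0 _|//|z0 /= z1] := ltgtP 0 z.2 => /andP[w2 w1].
    by apply: (Kc' _ (- w.2) z.2 z w) => //=; lra.
  have [w20|w20] := eqVneq w.2 0.
    exfalso; apply: K0; move: w1; rewrite w20 eqxx /= => w1.
    by apply: (Kc' _ (- w.1) z.1 z w) => //=; rewrite -?z0 ?w20; lra.
  have w2' : w.2 < 0 by rewrite lt_neqAle w20.
  by apply: (Kc' _ (- w.2) 0 z w) => //=; rewrite -?z0; lra.
(* A point on the positive first axis and one on the closed negative side would put the origin into
   [K]. *)
have same z w z' w' : K z -> K w -> upper z -> ~~ upper w ->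
    K z' -> K w' -> upper z' -> ~~ upper w' ->
    crossp z w < 0 -> 0 <= crossp z' w' -> False.
  move=> Kz Kw uz uw Kz' Kw' uz' uw' c0 c0'.
  apply: K0; apply: (Kc' _ (crossp z' w') (- crossp z w) _ _
     (axis z w Kz Kw uz uw) (axis z' w' Kz' Kw' uz' uw')) => //=; lra.
(* The bit [b] records whether some pair in [K] crosses the positive side; by [same] all changes of
   half-plane within [K] then behave alike. *)
have [[z [w [Kz Kw uz uw c0]]]|none] := pselect (exists z w,
    [/\ K z, K w, upper z, ~~ upper w & crossp z w < 0]).
  exists true => z' w' Kz' Kw'; rewrite [in LHS]/ray /=.
  case uz' : (upper z'); case uw' : (upper w'); rewrite //= ?orbF.
    rewrite ltNge; apply/negP => c0'.
    by apply: (same z w z' w'); rewrite ?uw'.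
  have cE : crossp w' z' = - crossp z' w' by rewrite /crossp; ring.
  rewrite ltNge; apply/negP => c0'.
  by apply: (same z w w' z'); rewrite ?uz' // cE oppr_ge0.
exists false => z w Kz Kw; rewrite /ray /=.
case uz : (upper z); case uw : (upper w); rewrite //= ?orbF.
  by apply/negP => c0; apply: none; exists z, w; rewrite uz uw.
have cE : crossp w z = - crossp z w by rewrite /crossp; ring.
apply/negP => c0; apply: none; exists w, z; rewrite uz uw; split => //.
by rewrite cE oppr_lt0.
Qed.

Definition disjoint_segs p q (r s : R * R) : Prop :=
  forall x, segment p q x -> segment r s x -> False.

Lemma segmentl p q : segment p q p.
Proof.
exists 0; first by rewrite lexx ler01.
by rewrite subr0 scale1r scale0r addr0.
Qed.

Lemma segmentr p q : segment p q q.
Proof.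
exists 1; first by rewrite lexx ler01.
by rewrite subrr scale1r scale0r add0r.
Qed.

(** The differences of points of two disjoint segments span a convex cone without the origin. On it
    [ray] only detects changes of [upper], and these sum to zero around the square. *)
Lemma ray_square p q (r s : R * R) : disjoint_segs p q r s ->
  ray (p - r) (q - r) (+) ray (p - s) (q - s) =
  ray (p - r) (p - s) (+) ray (q - r) (q - s).
Proof.
move=> disj.
pose K (v : R * R) := exists a b c d : R, [/\ [/\ 0 <= a, 0 <= b, 0 <= c & 0 <= d],
  0 < a + b + c + d,
  v.1 = a * (p - r).1 + b * (q - r).1 + c * (q - s).1 + d * (p - s).1 &
  v.2 = a * (p - r).2 + b * (q - r).2 + c * (q - s).2 + d * (p - s).2].
have K1 : K (p - r) by exists 1, 0, 0, 0; split; [split|..]; rewrite ?lexx ?ler01 //; lra.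
have K2 : K (q - r) by exists 0, 1, 0, 0; split; [split|..]; rewrite ?lexx ?ler01 //; lra.
have K3 : K (q - s) by exists 0, 0, 1, 0; split; [split|..]; rewrite ?lexx ?ler01 //; lra.
have K4 : K (p - s) by exists 0, 0, 0, 1; split; [split|..]; rewrite ?lexx ?ler01 //; lra.
have [] := @ray_cone K.
- move=> e f z w e0 f0 ef [a [b [c [d [[a0 b0 c0 d0] s0 z1 z2]]]]].
  move=> [a' [b' [c' [d' [[a0' b0' c0' d0'] s0' w1 w2]]]]].
  exists (e * a + f * a'), (e * b + f * b'), (e * c + f * c'), (e * d + f * d').
  split => /=; [by split; rewrite addr_ge0 ?mulr_ge0| | |].
  + have [e1|e1] := ltP 0 e.
      have : 0 < e * (a + b + c + d) by rewrite mulr_gt0.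
      have : 0 <= f * (a' + b' + c' + d') by rewrite mulr_ge0 // ltW.
      by lra.
    have f1 : 0 < f by lra.
    have : 0 < f * (a' + b' + c' + d') by rewrite mulr_gt0.
    have : 0 <= e * (a + b + c + d) by rewrite mulr_ge0 // ltW.
    by lra.
  + by rewrite z1 w1 /=; ring.
  + by rewrite z2 w2 /=; ring.
- move=> [a [b [c [d [[a0 b0 c0 d0] s0 /= z1 z2]]]]].
  (* After division by [S] the vanishing combination gives a common point of the segments: [b + c]
     is the weight of [q], and [c + d] that of [s]. *)
  set S := a + b + c + d in s0.
  have S0 : S != 0 by rewrite gt_eqF.
  apply: (disj ((1 - (b + c) / S) *: p + ((b + c) / S) *: q)).
    exists ((b + c) / S) => //.
    by rewrite divr_ge0 ?addr_ge0 ?(ltW s0) //= ler_pdivrMr // mul1r /S; lra.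
  exists ((c + d) / S).
    by rewrite divr_ge0 ?addr_ge0 ?(ltW s0) //= ler_pdivrMr // mul1r /S; lra.
  have e1 : 1 - (b + c) / S = (a + d) / S by rewrite /S; field; rewrite -/S.
  have e2 : 1 - (c + d) / S = (a + b) / S by rewrite /S; field; rewrite -/S.
  rewrite e1 e2; case: p q r s {disj K1 K2 K3 K4 K} z1 z2 => p1 p2 [q1 q2] [r1 r2] [t1 t2] /= z1 z2.
  congr pair; rewrite /= /GRing.scale /=.
    apply: (mulfI S0); rewrite !mulrDr !mulrA ![S * _ / S]mulrAC divff // !mul1r; lra.
  apply: (mulfI S0); rewrite !mulrDr !mulrA ![S * _ / S]mulrAC divff // !mul1r; lra.
move=> b rb; rewrite !rb //.
by case: b {rb}; case: (upper (p - r)); case: (upper (q - r));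
  case: (upper (p - s)); case: (upper (q - s)).
Qed.

Lemma segmentC p q : segment p q = segment q p.
Proof.
by apply/seteqP; split => x [t t01 ->]; exists (1 - t);
  rewrite ?subKr 1?addrC //; move: t01; lra.
Qed.

Lemma segment0 z w : upper z -> ~~ upper w -> crossp z w = 0 -> segment z w 0.
Proof.
case: z w => [z1 z2] [w1 w2]; rewrite /upper /crossp /= negb_or negb_and -!leNgt.
move=> uz /andP[w2le w1le] c0.
have [lt0|le0] := ltP 0 (z2 - w2).
  have nz : z2 - w2 != 0 by rewrite gt_eqF.
  have z2ge : 0 <= z2 by case/orP: uz => [/ltW //|/andP[/eqP-> _]].
  exists (z2 / (z2 - w2)).
    by rewrite divr_ge0 ?(ltW lt0) //= ler_pdivrMr // mul1r; lra.
  have -> : 1 - z2 / (z2 - w2) = - w2 / (z2 - w2) by field.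
  congr pair; rewrite /= /GRing.scale /=; last by field.
  rewrite mulrAC [X in _ + X]mulrAC -mulrDl.
  by rewrite (_ : - w2 * z1 + z2 * w1 = 0) ?mul0r //; lra.
have z20 : z2 = 0 by case/orP: uz => [|/andP[/eqP-> _]] //; lra.
have w20 : w2 = 0 by lra.
move: uz w1le; rewrite z20 w20 ltxx eqxx /= => z1gt w1le.
have lt0 : 0 < z1 - w1 by lra.
have nz : z1 - w1 != 0 by rewrite gt_eqF.
exists (z1 / (z1 - w1)).
  by rewrite divr_ge0 ?(ltW lt0) ?(ltW z1gt) //= ler_pdivrMr // mul1r; lra.
by congr pair; rewrite /= /GRing.scale /=; field.
Qed.

(** A segment that misses the origin and changes half-plane crosses exactly one of the two halves of
    the first axis, and negation exchanges them. *)
Lemma rayN z w : ~ segment z w 0 ->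
  ray (- z) (- w) = ray z w (+) upper z (+) upper w.
Proof.
move=> n0.
have z0 : z != 0 by apply/eqP => e; apply: n0; rewrite -[X in segment _ _ X]e; exact: segmentl.
have w0 : w != 0 by apply/eqP => e; apply: n0; rewrite -[X in segment _ _ X]e; exact: segmentr.
have cE : crossp (- z) (- w) = crossp z w by rewrite /crossp /=; ring.
rewrite /ray cE !upperN // !negbK.
case uz : (upper z); case uw : (upper w); rewrite //= ?orbF.
  have [//|//|c0] := ltgtP (crossp z w) 0; case: n0.
  by apply: segment0; rewrite ?uw.
have [//|//|c0] := ltgtP (crossp z w) 0; case: n0.
rewrite segmentC; apply: segment0; rewrite ?uz //.
by move: c0; rewrite /crossp; lra.
Qed.

(** * Crossing parities of polylines *)

Fixpoint segs p (s : seq (R * R)) : seq ((R * R) * (R * R)) :=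
  if s is q :: s' then (p, q) :: segs q s' else [::].

Lemma segs_cat p (s t : seq (R * R)) : segs p (s ++ t) = segs p s ++ segs (last p s) t.
Proof. by elim: s p => //= q s IHs p; rewrite IHs. Qed.

Lemma mem_segs p (s : seq (R * R)) e : e \in segs p s -> exists2 i, (i < size s)%N &
  e = (nth 0 (p :: s) i, nth 0 (p :: s) i.+1).
Proof.
elim: s p => //= q s IHs p; rewrite inE => /orP[/eqP ->|/IHs[i lti ->]].
  by exists 0%N.
by exists i.+1.
Qed.

(** On a side of the product of two polylines one factor stays at a point [c]; the difference map is
    then x - c if the second factor is fixed, and c - x, counted by [crossingsN], if the first one
    is. *)
Fixpoint crossings c p (s : seq (R * R)) : bool :=
  if s is q :: s' then ray (p - c) (q - c) (+) crossings c q s' else false.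

Fixpoint crossingsN c p (s : seq (R * R)) : bool :=
  if s is q :: s' then ray (c - p) (c - q) (+) crossingsN c q s' else false.

(** [rayN] on each segment; the half-plane bits of the inner points cancel in pairs. *)
Lemma crossingsNE c p (s : seq (R * R)) : (forall e, e \in segs p s -> ~ segment e.1 e.2 c) ->
  crossingsN c p s = crossings c p s (+) upper (p - c) (+) upper (last p s - c).
Proof.
elim: s p => [|q s IHs] p avoid /=; first by rewrite addbb.
rewrite IHs => [|e es]; last by apply: avoid; rewrite inE es orbT.
rewrite -(opprB p) -(opprB q) rayN.
  move: (ray _ _) (crossings _ _ _) (upper _) (upper _) (upper _).
  by do 5 case.
  
case=> t t01 /eqP; rewrite eq_sym => /eqP e0.
apply: (avoid (p, q)); first by rewrite inE eqxx.
exists t => //=; apply/eqP; rewrite eq_sym -subr_eq0 -e0; apply/eqP.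
case: p q c {IHs avoid e0} => [p1 p2] [q1 q2] [c1 c2].
by congr pair; rewrite /= /GRing.scale /=; ring.
Qed.

(** The squares of one segment against consecutive segments share sides, which cancel mod 2. *)
Lemma crossings_strip p q c (s : seq (R * R)) :
  (forall e, e \in segs c s -> disjoint_segs p q e.1 e.2) ->
  ray (p - c) (q - c) (+) ray (p - last c s) (q - last c s) =
  crossingsN p c s (+) crossingsN q c s.
Proof.
elim: s c => [|d s IHs] c disj /=; first by rewrite addbb.
have disj' e : e \in segs d s -> disjoint_segs p q e.1 e.2.
  by move=> es; apply: disj; rewrite inE es orbT.
have square : disjoint_segs p q c d by apply: (disj (c, d)); rewrite inE eqxx.
have := IHs d disj'; have := ray_square square.
set x1 := crossingsN _ _ _; set x2 := crossingsN _ _ _.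
set x3 := ray _ _; set x4 := ray _ _; set x5 := ray _ _; set x6 := ray _ _.
set x7 := ray _ _.
by case: x1 x2 x3 x4 x5 x6 x7 => [] [] [] [] [] [] [].
Qed.

(** Adjacent strips cancel along their common side, so only the boundary of the product remains. *)
Lemma crossings_grid a (s : seq (R * R)) c (t : seq (R * R)) :
  (forall e f, e \in segs a s -> f \in segs c t ->
     disjoint_segs e.1 e.2 f.1 f.2) ->
  crossings c a s (+) crossings (last c t) a s =
  crossingsN a c t (+) crossingsN (last a s) c t.
Proof.
elim: s a => [|b s IHs] a disj /=; first by rewrite addbb.
have H : forall e f, e \in segs b s -> f \in segs c t ->
     disjoint_segs e.1 e.2 f.1 f.2.
  by move=> e f es ft; apply: disj; rewrite // inE es orbT.
have E2 : forall f, f \in segs c t -> disjoint_segs a b f.1 f.2.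
  by move=> f ft; apply: (disj (a, b)); rewrite // inE eqxx.
have := crossings_strip E2; have := IHs b H.
set x1 := crossings _ _ _; set x2 := crossings _ _ _.
set x3 := crossingsN _ _ _; set x4 := crossingsN _ _ _; set x5 := crossingsN _ _ _.
set x6 := ray _ _; set x7 := ray _ _.
by case: x1 x2 x3 x4 x5 x6 x7 => [] [] [] [] [] [] [].
Qed.

End RayParity.

(* Van Kampen's obstruction for K_{3,3}: summing over the 18 unordered pairs of
   disjoint edges, every term cancels except one unit per pair and the nine
   sign changes of [HB]. *)
Lemma K33_parity (NP NQ : nat -> nat -> nat -> bool) (HA HB g : nat -> nat -> bool) :
  (forall j j', (j < j' < 3)%N -> HB j' j = 1 + HB j j') ->
  (forall i i' j j', (i < i' < 3)%N -> (j < 3)%N -> (j' < 3)%N -> j != j' ->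
     NP i' i j + NQ j' i j + NP i i' j' + NQ j i' j' =
     HA i i' + (1 + g i j') + g i' j + HB j j') -> False.
Proof.
move=> HBN E; pose pairs := [:: (0, 1); (0, 2); (1, 2)]%N.
pose S := \sum_(p <- pairs) \sum_(q <- pairs)
  ((NP p.2 p.1 q.1 + NQ q.2 p.1 q.1 + NP p.1 p.2 q.2 + NQ q.1 p.2 q.2) +
   (NP p.2 p.1 q.2 + NQ q.1 p.1 q.2 + NP p.1 p.2 q.1 + NQ q.2 p.2 q.1)).
have bool2 : 1 + 1 = 0 :> bool by [].
(* Left-hand sides: each [NP i' i j] occurs for both choices of [j'], and each [NQ j' i j] for both
   choices of [i']. *)
have S0 : S = (1 + 1) * (\sum_(p <- pairs) \sum_(j <- [:: 0; 1; 2]%N)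
    (NP p.2 p.1 j + NP p.1 p.2 j) +
  \sum_(q <- pairs) \sum_(i <- [:: 0; 1; 2]%N) (NQ q.2 i q.1 + NQ q.1 i q.2)).
  by rewrite /S /pairs !big_cons !big_nil /=; ring.
(* Right-hand sides: 18 units and 9 more from [HBN] make 27 = 2 * 13 + 1, while every bit occurs an
   even number of times. *)
have S1 : S = (1 + 1) * (\sum_(p <- pairs) (HA p.1 p.2 + HA p.1 p.2 + HA p.1 p.2) +
    \sum_(i <- [:: 0; 1; 2]%N) \sum_(j <- [:: 0; 1; 2]%N) (g i j + g i j) +
    \sum_(q <- pairs) (HB q.1 q.2 + HB q.1 q.2 + HB q.1 q.2) + 13%:R) + 1.
  rewrite /S /pairs !big_cons !big_nil /= !E //.
  rewrite (HBN 0 1)%N // (HBN 0 2)%N // (HBN 1 2)%N //.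
  ring.
by move: S1; rewrite S0 bool2 !mul0r.
Qed.

Lemma other_index (i : nat) : exists i', (i' < 3)%N /\ i != i'.
Proof. by case: i => [|i]; [exists 1%N | exists 0%N]. Qed.

(** * No polygonal plane drawing of K_{3,3} *)

Section K33Polylines.
Variable R : realType.

Lemma mem_segsl (a : R * R) (s : seq (R * R)) : s != [::] ->
  exists2 e, e \in segs a s & segment e.1 e.2 a.
Proof.
case: s => // b s _; exists (a, b); first by rewrite inE eqxx.
exact: segmentl.
Qed.

Lemma mem_segsr (a : R * R) (s : seq (R * R)) : s != [::] ->
  exists2 e, e \in segs a s & segment e.1 e.2 (last a s).
Proof.
case/lastP: s => // s b _; exists (last a s, b).
  by rewrite -cats1 segs_cat mem_cat inE eqxx orbT.
by rewrite last_rcons; exact: segmentr.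
Qed.

(** [crossings_grid] for each pair of disjoint edges, with [crossingsNE] turning all four sides into
    [crossings]. The half-plane bits this produces are the [HA], [HB] and [g] of [K33_parity]. *)
Lemma K33_polylines (P Q : nat -> R * R) (W : nat -> nat -> seq (R * R)) :
  (forall i j, (i < 3)%N -> (j < 3)%N -> last (P i) (W i j) = Q j) ->
  (forall i j, (i < 3)%N -> (j < 3)%N -> W i j != [::]) ->
  (forall i i' j j', (i < 3)%N -> (i' < 3)%N -> (j < 3)%N -> (j' < 3)%N ->
     i != i' -> j != j' ->
     forall e f, e \in segs (P i) (W i j) -> f \in segs (P i') (W i' j') ->
     disjoint_segs e.1 e.2 f.1 f.2) -> False.
Proof.
move=> lastW W0 disj.
have avoidP i i' j' : (i < 3)%N -> (i' < 3)%N -> (j' < 3)%N -> i != i' ->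
    forall f, f \in segs (P i') (W i' j') -> ~ segment f.1 f.2 (P i).
  move=> i3 i3' j3' ii' f fW Pf.
  (* Another edge at [P i], ending away from [Q j'], is disjoint from the given one. *)
  have [j [j3 j'j]] := other_index j'; have jj' : j != j' by rewrite eq_sym.
  have [e eW Pe] := mem_segsl (P i) (W0 i j i3 j3).
  exact: (disj i i' j j' i3 i3' j3 j3' ii' jj' e f eW fW _ Pe Pf).
have avoidQ j i' j' : (j < 3)%N -> (i' < 3)%N -> (j' < 3)%N -> j != j' ->
    forall f, f \in segs (P i') (W i' j') -> ~ segment f.1 f.2 (Q j).
  move=> j3 i3' j3' jj' f fW Qf.
  have [i [i3 i'i]] := other_index i'; have ii' : i != i' by rewrite eq_sym.
  have [e eW] := mem_segsr (P i) (W0 i j i3 j3); rewrite lastW // => Qe.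
  exact: (disj i i' j j' i3 i3' j3 j3' ii' jj' e f eW fW _ Qe Qf).
have QQ j j' : (j < 3)%N -> (j' < 3)%N -> j != j' -> Q j != Q j'.
  move=> j3 j3' jj'; apply/eqP => e.
  have [f fW] := mem_segsr (P 0%N) (W0 0%N j' isT j3'); rewrite lastW //.
  by rewrite -e; apply: (avoidQ j 0%N j').
have PQ i j : (i < 3)%N -> (j < 3)%N -> P i != Q j.
  move=> i3 j3; apply/eqP => e.
  have [i' [i3' ii']] := other_index i.
  have [f fW] := mem_segsr (P i') (W0 i' j i3' j3); rewrite lastW //.
  by rewrite -e; apply: (avoidP i i' j).
apply: (@K33_parity (fun c i j => crossings (P c) (P i) (W i j))
  (fun c i j => crossings (Q c) (P i) (W i j))
  (fun i i' => upper (P i' - P i)) (fun j j' => upper (Q j' - Q j))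
  (fun i j => upper (P i - Q j))).
  move=> j j' /andP[jj' j3'].
  by rewrite -opprB upperN // subr_eq0 QQ // 1?eq_sym ?neq_ltn ?jj' // (ltn_trans jj').
move=> i i' j j' /andP[ii' i3'] j3 j3' jj'.
have i3 : (i < 3)%N := ltn_trans ii' i3'.
have ni : i != i' by rewrite neq_ltn ii'.
have := crossings_grid (disj i i' j j' i3 i3' j3 j3' ni jj').
rewrite !lastW // !crossingsNE; first last.
- exact: avoidP.
- exact: avoidQ.
rewrite !lastW //.
have -> : upper (Q j' - P i) = 1 + upper (P i - Q j').
  by rewrite -opprB upperN // subr_eq0 PQ.
set x1 := crossings _ _ _; set x2 := crossings _ _ _.
set x3 := crossings _ _ _; set x4 := crossings _ _ _.
move: (upper _) (upper _) (upper _) (upper _).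
by case: x1 x2 x3 x4 => [] [] [] [] [] [] [] [].
Qed.

End K33Polylines.

(** * From crossing-free drawings to disjoint polylines *)

Section K33Drawing.
Variables (R : realType) (V : finType) (G : graph V) (D : drawing R V).
Hypothesis cfD : crossing_free G D.

Fixpoint walk_points (u : V) (w : seq V) : seq (R * R) :=
  if w is v :: w' then rcons (bends D u v) (pos D v) ++ walk_points v w'
  else [::].

Lemma last_walk_points u w : last (pos D u) (walk_points u w) = pos D (last u w).
Proof. by elim: w u => //= v w IHw u; rewrite last_cat last_rcons IHw. Qed.

Lemma segs_edge_arc u v e x : e \in segs (pos D u) (rcons (bends D u v) (pos D v)) ->
  segment e.1 e.2 x -> polyline (edge_arc D u v) x.
Proof. by move=> /mem_segs[i lti ->] /= ex; exists i. Qed.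

Lemma segs_walk_points u w e : path G u w -> e \in segs (pos D u) (walk_points u w) ->
  exists a b, [/\ G a b, a \in u :: w, b \in u :: w &
    forall x, segment e.1 e.2 x -> polyline (edge_arc D a b) x].
Proof.
elim: w u => //= v w IHw u /andP[Guv pvw]; rewrite segs_cat mem_cat last_rcons.
case/orP => [euv|/(IHw _ pvw)[a [b [Gab av bv H]]]].
  exists u, v; rewrite !inE !eqxx orbT; split => // x; exact: segs_edge_arc.
by exists a, b; split; rewrite // inE ?av ?bv orbT.
Qed.

(** Arcs of a crossing-free drawing meet only at a common end of their edges, and disjoint walks
    have none. *)
Lemma disjoint_walks u w u' w' : path G u w -> path G u' w' ->
  (forall x, x \in u :: w -> x \in u' :: w' -> False) ->
  forall e f, e \in segs (pos D u) (walk_points u w) ->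
    f \in segs (pos D u') (walk_points u' w') -> disjoint_segs e.1 e.2 f.1 f.2.
Proof.
move=> pw pw' disj e f /(segs_walk_points pw)[a [b [Gab aw bw ab]]].
move=> /(segs_walk_points pw')[a' [b' [Gab' aw' bw' ab']]] x ex fx.
have [_ _ _ cross] := cfD.
have disj2 z : z \in [set a; b]%SET -> z \in [set a'; b']%SET -> False.
  by move=> /set2P z1 /set2P z2; apply: (disj z); [case: z1 => -> | case: z2 => ->].
have [|z] := cross _ _ _ _ x Gab Gab' _ (ab x ex) (ab' x fx).
  apply/eqP => E; apply: (disj2 a); first by rewrite !inE eqxx.
  by rewrite -E !inE eqxx.
by rewrite inE => /andP[z1 z2] _; exact: disj2 z1 z2.
Qed.

End K33Drawing.

Lemma connect_walk (V : finType) (G : rel V) (S : pred V) u v :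
  u \in S -> connect [rel x y | [&& G x y, x \in S & y \in S]] u v ->
  exists w, [/\ path G u w, last u w = v & {subset u :: w <= S}].
Proof.
move=> uS /connectP[w pw ->]; exists w; split => //.
  by elim: w u uS pw => //= x w IHw u uS /andP[/and3P[-> _ xS] /IHw->].
move=> z; rewrite inE => /orP[/eqP->//|].
elim: w u uS pw => //= x w IHw u uS /andP[/and3P[_ _ xS] pw].
by rewrite inE => /orP[/eqP->//|]; exact: IHw pw.
Qed.

(** [S i j] holds the vertices of a path that plays the edge from [p i] to [q j]. The parity
    argument compares disjoint edges only, so disjointness is asked of their regions alone. *)
Lemma K33_nonplanar (R : realType) (V : finType) (G : graph V) (p q : nat -> V)
    (S : nat -> nat -> pred V) :
  (forall i j, (i < 3)%N -> (j < 3)%N -> p i \in S i j /\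
     connect [rel x y | [&& G x y, x \in S i j & y \in S i j]] (p i) (q j)) ->
  (forall i i' j j' x, (i < 3)%N -> (i' < 3)%N -> (j < 3)%N -> (j' < 3)%N ->
     i != i' -> j != j' -> x \in S i j -> x \in S i' j' -> False) ->
  ~ planar R G.
Proof.
move=> conn disj [D cfD].
have /choice[W Wp] : forall ij : nat * nat, exists w, (ij.1 < 3)%N -> (ij.2 < 3)%N ->
    [/\ path G (p ij.1) w, last (p ij.1) w = q ij.2 &
     {subset p ij.1 :: w <= S ij.1 ij.2}].
  move=> [i j] /=; have [i3|] := boolP (i < 3)%N; last by exists [::].
  have [j3|] := boolP (j < 3)%N; last by exists [::].
  have [pS cS] := conn i j i3 j3.
  by have [w Hw] := connect_walk pS cS; exists w.
have W0 i j : (i < 3)%N -> (j < 3)%N -> W (i, j) != [::].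
  move=> i3 j3; apply/eqP => Wij.
  (* An empty walk would make [p i = q j] a common vertex of the regions [S i j'] and [S i' j]. *)
  have [_ /= lastE _] := Wp (i, j) i3 j3; rewrite Wij /= in lastE.
  have [i' [i3' ii']] := other_index i.
  have [j' [j3' jj']] := other_index j.
  have ji' : j' != j by rewrite eq_sym.
  have [pS _] := conn i j' i3 j3'.
  have [_ /= lastE' sub] := Wp (i', j) i3' j3.
  apply: (disj i i' j' j (p i)) => //.
  by apply: sub; rewrite lastE -lastE' mem_last.
apply: (@K33_polylines R (pos D \o p) (pos D \o q)
  (fun i j => walk_points D (p i) (W (i, j)))).
- move=> i j i3 j3 /=; rewrite last_walk_points.
  by have [_ /= -> _] := Wp (i, j) i3 j3.
- move=> i j i3 j3; have := W0 i j i3 j3; case: (W (i, j)) => //= v w _.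
  by case: (bends _ _ _).
move=> i i' j j' i3 i3' j3 j3' ii' jj' e f.
have [p1 _ s1] := Wp (i, j) i3 j3; have [p2 _ s2] := Wp (i', j') i3' j3'.
apply: (disjoint_walks cfD) => // x xw xw'.
by apply: (disj i i' j j' x) => //; [exact: s1|exact: s2].
Qed.

(** * Straight-line drawings with the vertices on a parabola *)

Section Parabola.
Variables (R : realType) (V : finType) (G : graph V) (f : V -> nat).
Hypothesis f_inj : injective f.
Hypothesis noncrossing : forall u v u' v', G u v -> G u' v' ->
  ~ [/\ (f u < f u')%N, (f u' < f v)%N & (f v < f v')%N].

Local Notation F v := ((f v)%:R : R).

(** Points of a parabola are in convex position, so chords cross in their interiors only if their
    ends interleave in the order [f]. *)
Definition parabola : drawing R V :=
  Drawing (fun v => (F v, F v ^+ 2)) (fun _ _ => [::]).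

Lemma parabola_pos_inj : injective (pos parabola).
Proof.
by move=> u v [/eqP]; rewrite eqr_nat => /eqP /f_inj.
Qed.

Lemma parabola_arc u v x : polyline (edge_arc parabola u v) x ->
  (F u <= x.1 <= F v \/ F v <= x.1 <= F u) /\
  x.2 = x.1 * (F u + F v) - F u * F v.
Proof.
case=> -[|i] //= _ [t t01 ->] /=; rewrite /GRing.scale /=; split; last by ring.
have [uv|vu] := leP (F u) (F v).
  left; apply/andP; split; nra.
right; apply/andP; split; nra.
Qed.

Lemma parabola_arc_above u v x : polyline (edge_arc parabola u v) x ->
  x.1 ^+ 2 <= x.2.
Proof. by case/parabola_arc => -[] /andP[h1 h2] ->; nra. Qed.

(** At abscissa X the chord over [a, b] lies (X - a) (b - X) above the parabola, which strictly
    exceeds the height of a nested chord unless they share an end. *)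
Lemma nested_chords_meet (a b c d X : R) :
  a <= c -> c < d -> d <= b -> c <= X <= d ->
  X * (a + b) - a * b = X * (c + d) - c * d ->
  [\/ a = c /\ b = d, X = a /\ a = c | X = b /\ b = d].
Proof.
move=> ac cd db /andP[cX Xd] E.
have [ac'|ac'] := eqVneq a c.
  have [bd'|bd'] := eqVneq b d; first by constructor 1.
  constructor 2; split => //.
  have /eqP : (X - a) * (b - d) = 0 by rewrite ac' in E *; lra.
  by rewrite mulf_eq0 !subr_eq0 (negPf bd') orbF => /eqP.
have ac2 : a < c by rewrite lt_neqAle ac' ac.
constructor 3.
have E' : (X - a) * (b - X) = (X - c) * (d - X) by lra.
have [Xb'|Xb'] := eqVneq X b; first by split=> //; lra.
have Xb2 : X < b by rewrite lt_neqAle Xb'; lra.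
have : (X - c) * (d - X) <= (X - c) * (b - X) by rewrite ler_wpM2l; lra.
have : (X - c) * (b - X) < (X - a) * (b - X) by rewrite ltr_pM2r; lra.
by lra.
Qed.

Lemma parabola_meet u v u' v' x : G u v -> G u' v' ->
  (f u < f v)%N -> (f u' < f v')%N ->
  polyline (edge_arc parabola u v) x -> polyline (edge_arc parabola u' v') x ->
  (u = u' /\ v = v') \/
  exists2 w, w \in ([set u; v] :&: [set u'; v'])%SET & x = pos parabola w.
Proof.
move=> Guv Guv' uv uv' /parabola_arc[hx hy] /parabola_arc[hx' hy'].
have ltF (a b : V) : (f a < f b)%N -> F a < F b by rewrite ltr_nat.
have {}hx : F u <= x.1 <= F v by case: hx => // h; move: (ltF u v uv) h; lra.
have {}hx' : F u' <= x.1 <= F v' by case: hx' => // h; move: (ltF u' v' uv') h; lra.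
have eqF (a b : V) : F a = F b -> a = b by move/eqP; rewrite eqr_nat => /eqP/f_inj.
have meet w : x.1 = F w -> w \in [set u; v]%SET -> w \in [set u'; v']%SET ->
    exists2 w, w \in ([set u; v] :&: [set u'; v'])%SET & x = pos parabola w.
  move=> xw wuv wuv'; exists w; first by rewrite inE wuv.
  rewrite [x]surjective_pairing hy xw /=; congr pair.
  by move: wuv => /set2P[] ->; ring.
have hyy : x.1 * (F u + F v) - F u * F v = x.1 * (F u' + F v') - F u' * F v'.
  by rewrite -hy -hy'.
(* Two intervals that do not interleave are apart or nested. *)
have : [\/ F v <= F u', F v' <= F u, F u <= F u' /\ F v' <= F v |
           F u' <= F u /\ F v <= F v'].
  have nc1 : ~~ [&& f u < f u', f u' < f v & f v < f v']%N.
    by apply/and3P; exact: noncrossing.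
  have nc2 : ~~ [&& f u' < f u, f u < f v' & f v' < f v]%N.
    by apply/and3P; exact: noncrossing.
  have : [|| f v <= f u', f v' <= f u, (f u <= f u') && (f v' <= f v) |
             (f u' <= f u) && (f v <= f v')]%N.
    by move: (f u) (f v) (f u') (f v') uv uv' nc1 nc2 => *; lia.
  rewrite !ler_nat => /or4P[||/andP|/andP] ?;
    by [constructor 1|constructor 2|constructor 3|constructor 4].
case=> [vu'|v'u|[uu' v'v]|[u'u vv']].
- right; have xv : x.1 = F v by lra.
  have vu : v = u' by apply: eqF; lra.
  by apply: (meet v xv); rewrite !inE ?vu eqxx ?orbT.
- right; have xu : x.1 = F u by lra.
  have vu : u = v' by apply: eqF; lra.
  by apply: (meet u xu); rewrite !inE ?vu eqxx ?orbT.
- have := nested_chords_meet uu' (ltF _ _ uv') v'v hx' hyy.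
  case=> [[/eqF e1 /eqF e2]|[xu /eqF e]|[xv /eqF e]]; first by left.
    by right; apply: (meet u xu); rewrite !inE ?e eqxx ?orbT.
  by right; apply: (meet v xv); rewrite !inE ?e eqxx ?orbT.
have := nested_chords_meet u'u (ltF _ _ uv) vv' hx (esym hyy).
case=> [[/eqF e1 /eqF e2]|[xu /eqF e]|[xv /eqF e]]; first by left.
  by right; apply: (meet u'  xu); rewrite !inE ?e eqxx ?orbT.
by right; apply: (meet v' xv); rewrite !inE ?e eqxx ?orbT.
Qed.

Lemma parabola_arcC u v x :
  polyline (edge_arc parabola u v) x -> polyline (edge_arc parabola v u) x.
Proof.
by case=> -[|i] //= _ Hx; exists 0%N => //=; rewrite segmentC.
Qed.

Lemma crossing_free_parabola : crossing_free G parabola.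
Proof.
have fne u v : G u v -> (f u < f v)%N || (f v < f u)%N.
  move=> Guv; rewrite -neq_ltn; apply/eqP => /f_inj e.
  by move: Guv; rewrite e (adj_irr G).
split.
- exact: parabola_pos_inj.
- move=> u v Guv; split => //; split.
    case=> [|i] //= _; apply/eqP => /parabola_pos_inj e.
    by move: Guv; rewrite e (adj_irr G).
  by move=> [|i] [|[|j]].
- move=> u v w Guv /parabola_arc[_ /= wE].
  have /eqP : (F w - F u) * (F w - F v) = 0 by lra.
  rewrite mulf_eq0 !subr_eq0 !eqr_nat => /orP[] /eqP /f_inj ->; first by left.
  by right.
move=> u v u' v' x Guv Guv' ne ux ux'.
have Gvu : G v u by rewrite (adj_sym G).
have Gvu' : G v' u' by rewrite (adj_sym G).
have [lt1|lt1] := orP (fne _ _ Guv); have [lt2|lt2] := orP (fne _ _ Guv').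
- case: (parabola_meet Guv Guv' lt1 lt2 ux ux') => // -[e1 e2].
  by rewrite e1 e2 eqxx in ne.
- case: (parabola_meet Guv Gvu' lt1 lt2 ux (parabola_arcC ux')) => [[e1 e2]|].
    by rewrite e1 e2 finset.setUC eqxx in ne.
  by rewrite [[set v'; u']%SET]finset.setUC.
- case: (parabola_meet Gvu Guv' lt1 lt2 (parabola_arcC ux) ux') => [[e1 e2]|].
    by rewrite e1 e2 finset.setUC eqxx in ne.
  by rewrite [[set v; u]%SET]finset.setUC.
- case: (parabola_meet Gvu Gvu' lt1 lt2 (parabola_arcC ux) (parabola_arcC ux')).
    by move=> [e1 e2]; rewrite e1 e2 eqxx in ne.
  by rewrite [[set v; u]%SET]finset.setUC [[set v'; u']%SET]finset.setUC.
Qed.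

Definition below_parabola : set (R * R) := [set x | x.2 < x.1 ^+ 2].

Lemma below_parabola_undrawn : below_parabola `<=` ~` drawn G parabola.
Proof.
move=> x /= xB [[v xv]|[u [v [_ /parabola_arc_above]]]].
  by move: xB; rewrite xv /below_parabola /= ltxx.
by rewrite leNgt; apply/negP/negPn.
Qed.

Lemma below_parabola_face x :
  below_parabola x -> face_of G parabola (0, -1) x.
Proof.
(* The depth below the parabola runs linearly from 1 to that of [x], so the curve stays below. *)
move=> xB; pose g (t : R) : R * R :=
  (t * x.1, (t * x.1) ^+ 2 - ((1 - t) + t * (x.1 ^+ 2 - x.2))).
exists (g @` `[0, 1]).
  split.
  - exists 0 => /=; first by rewrite in_itv /= lexx ler01.
    by rewrite /g; congr pair; ring.
  - move=> _ [t /= t01 <-]; apply: below_parabola_undrawn.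
    move: xB t01; rewrite /below_parabola /g /= in_itv /= => xB /andP[t0 t1].
    rewrite gtrDl oppr_lt0; have [->|t0'] := eqVneq t 0; first lra.
    have : 0 < t by rewrite lt_neqAle eq_sym t0'.
    move=> tp; have : 0 < t * (x.1 ^+ 2 - x.2) by rewrite mulr_gt0 ?subr_gt0.
    by lra.
  - apply: connected_continuous_connected; first exact: segment_connected.
    apply: continuous_subspaceT => t.
    have c1 : t' * x.1 @[t' --> t] --> t * x.1.
      by apply: cvgMr_tmp; exact: cvg_id.
    apply: (cvg_pair c1 (cvgB (cvgM c1 c1) _)).
    apply: cvgD; last by apply: cvgMr_tmp; exact: cvg_id.
    by apply: cvgB; [exact: cvg_cst|exact: cvg_id].
exists 1 => /=; first by rewrite in_itv /= lexx ler01.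
by rewrite /g [RHS]surjective_pairing; congr pair; ring.
Qed.

(** The connected region below the parabola is unbounded and touches every vertex from below. *)
Lemma outerplanar_parabola : outerplanar R G.
Proof.
exists parabola; split; first exact: crossing_free_parabola.
exists (0, -1); split.
- by apply: below_parabola_undrawn; rewrite /below_parabola /=; lra.
- move=> /pinfty_ex_gt0[M M0 /(_ (0, - (M + 2)))] /=.
  have facM : face_of G parabola (0, -1) (0, - (M + 2)).
    by apply: below_parabola_face; rewrite /below_parabola /= expr0n /=; lra.
  move=> /(_ facM); rewrite prod_normE /= ge_max => /andP[_].
  by have := ler_norm (M + 2); rewrite normrN; lra.
move=> v B /nbhs_ballP[e /= e0 eB].
exists (F v, F v ^+ 2 - e / 2); split.
  by apply: below_parabola_face; rewrite /below_parabola /=; lra.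
apply: eB; split => /=; first exact: ballxx.
by rewrite /ball /= opprB addrC subrK gtr0_norm; lra.
Qed.

(** The chord from [v] to [u] has slope [F v + F u], and [pi] is added when it leads to the left.
    All angles lie strictly between - pi / 2 and 3 pi / 2, within one turn. *)
Definition angle (v u : V) : R :=
  atan (F v + F u) + (if (f u < f v)%N then pi else 0).

Lemma angle_spread v u w : angle v u - pi *+ 2 < angle v w.
Proof.
rewrite /angle; have := @pi_gt0 R.
have := @atan_ltpi2 R (F v + F u); have := @atan_gtNpi2 R (F v + F w).
by case: ifP; case: ifP; lra.
Qed.

Lemma angle_inj v u w : u != v -> w != v -> angle v u = angle v w -> u = w.
Proof.
move=> uv wv; rewrite /angle.
have := @atan_ltpi2 R (F v + F u); have := @atan_gtNpi2 R (F v + F w).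
have := @atan_ltpi2 R (F v + F w); have := @atan_gtNpi2 R (F v + F u).
have inj : atan (F v + F u) = atan (F v + F w) -> u = w.
  by move=> /(can_inj (@atanK R)) /addrI /eqP; rewrite eqr_nat => /eqP /f_inj.
by case: ifP; case: ifP => _ _ h1 h2 h3 h4 E; (apply: inj; lra) || (exfalso; lra).
Qed.

Definition clockwise_nbrs (v : V) : seq V :=
  sort (fun u w => angle v w <= angle v u) (enum (G v)).

Lemma clockwise_nbrs_uniq v : uniq (clockwise_nbrs v).
Proof. by rewrite sort_uniq enum_uniq. Qed.

Lemma mem_clockwise_nbrs v : clockwise_nbrs v =i G v.
Proof. by move=> u; rewrite mem_sort mem_enum. Qed.

Lemma direction_angle v u : u != v -> exists2 r : R, 0 < r &
  direction parabola v u = (r * cos (angle v u), r * sin (angle v u)).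
Proof.
move=> uv; set t := atan (F v + F u).
have ct : 0 < cos t by apply: cos_gt0_pihalf; rewrite atan_gtNpi2 atan_ltpi2.
have tE : F v + F u = sin t / cos t by rewrite -[LHS]atanK.
have dE : direction parabola v u = (F u - F v, (F u - F v) * (F v + F u)).
  by rewrite /direction /=; congr pair => /=; ring.
rewrite dE tE /angle -/t.
have [uv'|vu] := ltnP (f u) (f v).
  exists ((F v - F u) / cos t); first by rewrite divr_gt0 // subr_gt0 ltr_nat.
  by rewrite cosDpi sinDpi; congr pair; field; rewrite gt_eqF.
exists ((F u - F v) / cos t).
  rewrite divr_gt0 // subr_gt0 ltr_nat ltn_neqAle vu andbT.
  by apply: contra uv => /eqP/f_inj->.
by rewrite addr0; congr pair; field; rewrite gt_eqF.
Qed.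

Lemma planar_embedding_parabola : planar_embedding R G clockwise_nbrs.
Proof.
exists parabola; split; first exact: crossing_free_parabola.
move=> v; exists (fun i => angle v (nth v (clockwise_nbrs v) i)).
have nbr i : (i < size (clockwise_nbrs v))%N -> nth v (clockwise_nbrs v) i != v.
  move=> lti; have := mem_nth v lti; rewrite mem_clockwise_nbrs.
  by apply: contraTneq => ->; rewrite -topredE /= (adj_irr G).
split=> [i j ij lj|i _|i lti].
- have li := ltn_trans ij lj.
  rewrite lt_neqAle; apply/andP; split.
    apply/eqP => /(angle_inj (nbr j lj) (nbr i li))/eqP.
    by rewrite nth_uniq ?clockwise_nbrs_uniq // gtn_eqF.
  have tr : transitive (fun u w => angle v w <= angle v u).
    by move=> a b c h1 h2; exact: le_trans h2 h1.
  have := sort_sorted (fun a b => le_total (angle v b) (angle v a)) (enum (G v)).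
  by move=> /(sorted_ltn_nth tr v)/(_ i j li lj ij).
- exact: angle_spread.
exact: direction_angle (nbr i lti).
Qed.

End Parabola.

(** * Degrees in series-parallel graphs *)

Definition set_degree (V : finType) (H : {set {set V}}) (v : V) : nat :=
  #|[set e in H | v \in e]|.

Lemma sp_graph_sub (V : finType) (U : {set V}) (E : {set {set V}}) s t :
  sp_graph U E s t ->
  [/\ s \in U, t \in U, s != t & forall e, e \in E -> e \subset U].
Proof.
elim=> {U E s t} [s t st|U1 U2 E1 E2 s m t _ [s1 m1 sm s1E] _ [m2 t2 mt s2E] U12|
  U1 U2 E1 E2 s t _ [s1 t1 st s1E] _ [s2 t2 _ s2E] U12 E12].
- by split; rewrite ?set21 ?set22 // => e /set1P->.
- split; rewrite ?inE ?s1 ?t2 ?orbT //.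
    apply/eqP => st; have : s \in U1 :&: U2 by rewrite inE s1 st t2.
    by rewrite U12 => /set1P e; rewrite e eqxx in sm.
  move=> e /setUP[/s1E|/s2E] /fintype.subset_trans; apply;
    [exact: finset.subsetUl|exact: finset.subsetUr].
split; rewrite ?inE ?s1 ?t2 ?orbT //.
by move=> e /setUP[/s1E|/s2E] /fintype.subset_trans; apply;
    [exact: finset.subsetUl|exact: finset.subsetUr].
Qed.

Lemma set_degree_setI (V : finType) (E1 E2 H : {set {set V}}) (v : V) :
  H \subset E1 :|: E2 -> (forall e, e \in E2 -> v \notin e) ->
  set_degree (H :&: E1) v = set_degree H v.
Proof.
move=> HE nE2; apply: eq_card => e; rewrite !inE.
have [eH|//] := boolP (e \in H); have [ve|] := boolP (v \in e); last by rewrite !andbF.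
by have /setUP[->//|/nE2] := fintype.subsetP HE e eH; rewrite ve.
Qed.

(** Induction on the composition. In a series composition both parts of [H] have at most one edge,
    so the middle vertex has degree at most 2 and [H] must be empty; in a parallel one both parts
    lie in the same single edge. *)
Lemma sp_graph_degree (V : finType) (U : {set V}) (E : {set {set V}}) s t :
  sp_graph U E s t -> forall H : {set {set V}}, H \subset E ->
  (forall v e, v != s -> v != t -> e \in H -> v \in e -> (2 < set_degree H v)%N) ->
  H \subset [set [set s; t]]%SET.
Proof.
(* Restricting [H] to one part keeps the degrees of its inner vertices, which lie on no edge of the
   other part. In a series composition [z] is the far terminal. *)
have step (U1 U2 : {set V}) (E1 E2 H : {set {set V}}) x y z :
    (forall e, e \in E1 -> e \subset U1) -> (forall e, e \in E2 -> e \subset U2) ->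
    (forall v, v \in U1 -> v \in U2 -> v != x -> v != y -> False) ->
    (forall v, v \in U1 -> v = z -> v != x -> v != y -> False) ->
    H \subset E1 :|: E2 ->
    (forall v e, v != x -> v != y -> v != z -> e \in H -> v \in e -> (2 < set_degree H v)%N) ->
    forall v e, v != x -> v != y -> e \in H :&: E1 -> v \in e ->
      (2 < set_degree (H :&: E1) v)%N.
  move=> sub1 sub2 U12 z1 HE deg v e vx vy /setIP[eH e1] ve.
  have v1 := fintype.subsetP (sub1 e e1) v ve.
  rewrite (set_degree_setI HE) ?(deg v e) //.
    by apply/eqP => vz; exact: z1 vz vx vy.
  move=> g g2; apply/negP => vg.
  exact: U12 v1 (fintype.subsetP (sub2 g g2) v vg) vx vy.
elim=> {U E s t} [//|U1 U2 E1 E2 s m t sp1 IH1 sp2 IH2 U12|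
  U1 U2 E1 E2 s t sp1 IH1 sp2 IH2 U12 E12] H HE deg.
- have [s1 m1 sm sub1] := sp_graph_sub sp1; have [m2 t2 mt sub2] := sp_graph_sub sp2.
  have HE' : H \subset E2 :|: E1 by rewrite finset.setUC.
  have onlym v : v \in U1 -> v \in U2 -> v != m -> False.
    move=> v1 v2; have : v \in U1 :&: U2 by rewrite inE v1.
    by rewrite U12 => /set1P-> /eqP.
  have H1 : H :&: E1 \subset [set [set s; m]]%SET.
    apply: IH1; first exact: finset.subsetIr.
    apply: (step U1 U2 E1 E2 H s m t sub1 sub2 _ _ HE).
    + by move=> v v1 v2 _; exact: onlym.
    + by move=> v v1 vt _; apply: onlym => //; rewrite vt.
    by move=> v e vs _ vt; exact: deg.
  have H2 : H :&: E2 \subset [set [set m; t]]%SET.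
    apply: IH2; first exact: finset.subsetIr.
    apply: (step U2 U1 E2 E1 H m t s sub2 sub1 _ _ HE').
    + by move=> v v2 v1 vm _; exact: onlym v1 v2 vm.
    + by move=> v v2 vs vm _; apply: (onlym v) => //; rewrite vs.
    by move=> v e _ vt vs; exact: deg.
  have Hm e : e \in H -> e \in [set [set s; m]; [set m; t]]%SET.
    move=> eH; have /setUP[e1|e2] := fintype.subsetP HE e eH.
      have /set1P-> : e \in [set [set s; m]]%SET.
        by apply: (fintype.subsetP H1); rewrite inE eH.
      by rewrite set21.
    have /set1P-> : e \in [set [set m; t]]%SET.
      by apply: (fintype.subsetP H2); rewrite inE eH.
    by rewrite set22.
  apply/fintype.subsetP => e eH; exfalso.
  have me : m \in e by have /set2P[] := Hm e eH => ->; rewrite !inE eqxx ?orbT.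
  have := deg m e; rewrite eq_sym sm mt eH me => /(_ isT isT isT isT).
  rewrite ltnNge => /negP; apply.
  apply: leq_trans (_ : #|[set [set s; m]; [set m; t]]%SET| <= 2)%N; last first.
    by rewrite cards2; case: (_ != _).
  by apply: subset_leq_card; apply/fintype.subsetP => g; rewrite inE => /andP[/Hm].
have [s1 t1 st sub1] := sp_graph_sub sp1; have [s2 t2 _ sub2] := sp_graph_sub sp2.
have HE' : H \subset E2 :|: E1 by rewrite finset.setUC.
have onlyst v : v \in U1 -> v \in U2 -> v != s -> v != t -> False.
  move=> v1 v2; have : v \in U1 :&: U2 by rewrite inE v1.
  by rewrite U12 => /set2P[] -> /eqP // _ /eqP.
have H1 : H :&: E1 \subset [set [set s; t]]%SET.
  apply: IH1; first exact: finset.subsetIr.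
  apply: (step U1 U2 E1 E2 H s t s sub1 sub2 onlyst _ HE).
    by move=> v _ -> /eqP.
  by move=> v e vs vt _; exact: deg.
have H2 : H :&: E2 \subset [set [set s; t]]%SET.
  apply: IH2; first exact: finset.subsetIr.
  apply: (step U2 U1 E2 E1 H s t s sub2 sub1 _ _ HE').
  - by move=> v v2 v1; exact: onlyst.
  - by move=> v _ -> /eqP.
  by move=> v e vs vt _; exact: deg.
apply/fintype.subsetP => e eH.
by have /setUP[e1|e2] := fintype.subsetP HE e eH;
  [apply: (fintype.subsetP H1)|apply: (fintype.subsetP H2)]; rewrite inE eH.
Qed.

(** All edges inside [W] would coincide with the edge between the terminals, yet [w] lies on three
    of them. *)
Lemma min_degree_not_series_parallel (V : finType) (G : graph V) (W : {set V}) (w : V) :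
  w \in W -> (forall v, v \in W -> (2 < #|[set u in W | G v u]|)%N) ->
  ~ series_parallel G.
Proof.
move=> wW deg [s [t sp]].
pose H := [set e in edges G | e \subset W]%SET.
have degH v : v \in W -> (2 < set_degree H v)%N.
  move=> vW; apply: leq_trans (deg v vW) _.
  rewrite -(card_in_imset (f := fun u => [set v; u]%SET)).
    apply: subset_leq_card; apply/fintype.subsetP => _ /imsetP[u + ->].
    rewrite !inE => /andP[uW Gvu]; rewrite eqxx /= andbT; apply/andP; split.
      by apply/imsetP; exists (v, u); rewrite ?inE.
    by apply/fintype.subsetP => z /set2P[]->.
  move=> u u'; rewrite !inE => /andP[_ Gu] /andP[_ Gu'] E.
  have : u \in [set v; u']%SET by rewrite -E set22.
  by move=> /set2P[uv|//]; rewrite uv (adj_irr G) in Gu.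
have HE : H \subset edges G by apply/fintype.subsetP => e; rewrite inE => /andP[].
have Hst : H \subset [set [set s; t]]%SET.
  apply: (sp_graph_degree sp HE) => v e _ _; rewrite inE => /andP[_ eW] ve.
  exact: degH (fintype.subsetP eW v ve).
have := degH w wW; rewrite ltnNge => /negP; apply.
apply: leq_trans (_ : #|[set [set s; t]]%SET| <= 2)%N; last by rewrite cards1.
apply: subset_leq_card; apply/fintype.subsetP => e; rewrite inE => /andP[eH _].
exact: (fintype.subsetP Hst).
Qed.

(** * Rooted trees and tree decompositions *)

Section RootedTree.
Variables (T : finType) (F : graph T).
Hypothesis treeF : is_tree F.
Variable r : T.

Definition avoiding (x : T) : rel T := [rel a b | [&& F a b, a != x & b != x]].

(** Seen from the root [r], this says that [y] lies outside the subtree of [x]; a neighbour of [x]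
    with this property is its parent. *)
Definition reaches (x y : T) : bool := (y != x) && connect (avoiding x) r y.

Lemma avoiding_sym x : connect_sym (avoiding x).
Proof.
apply: sym_connect_sym => a b; rewrite /avoiding /= (adj_sym F).
by case: (a != x); case: (b != x); rewrite ?andbF.
Qed.

Lemma reaches_path x w : path F r w -> x \notin r :: w -> reaches x (last r w).
Proof.
move=> pw xw; apply/andP; split.
  by apply: contraNneq xw => <-; exact: mem_last.
apply/connectP; exists w => //; rewrite /avoiding.
elim: w (r) pw xw => //= a w IHw b /andP[Fba pw].
rewrite !inE !negb_or => /and3P[xb xa xw].
by rewrite IHw // ?inE ?negb_or ?xa // Fba ![_ == x]eq_sym xb xa.
Qed.

(** A simple path from [r] to [x] either avoids [y] or has an initial part up to [y] that avoids
    [x]. *)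
Lemma reaches_total x y : x != y -> reaches x y || reaches y x.
Proof.
move=> xy; have [conn _] := treeF.
have /connectP[w0 pw0 xE] := conn r x; move: xE; case/shortenP: pw0 => w pw uw _ xE.
have [yw|yw] := boolP (y \in r :: w); last first.
  by rewrite [in reaches y _]xE (reaches_path pw yw) orbT.
case/splitPl: yw pw uw xE => w1 w2 yE; rewrite cat_path last_cat yE => /andP[pw1 _] uw xE.
have xw2 : x \in w2.
  by have := mem_last y w2; rewrite -xE inE (negPf xy).
rewrite -yE reaches_path //.
by move: uw; rewrite -cat_cons cat_uniq => /and3P[_ /hasPn/(_ x xw2)].
Qed.

Lemma reaches_root y : reaches r y = false.
Proof.
apply/negP => /andP[yr /connectP[[|a w] /= pw yE]]; first by rewrite yE eqxx in yr.
by move: pw; rewrite /avoiding /= eqxx andbF.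
Qed.

(** Two parents, joined by a simple path avoiding [x], would close a cycle through [x]. *)
Lemma parent_uniq x p q :
  F p x -> reaches x p -> F q x -> reaches x q -> p = q.
Proof.
move=> Fp /andP[px rp] Fq /andP[qx rq]; apply/eqP/negPn/negP => pq.
have : connect (avoiding x) p q.
  by apply: connect_trans rq; rewrite avoiding_sym.
case/connectP => w0 pw0 qE; move: qE; case/shortenP: pw0 => w pw uw _ qE.
have w0n : w != [::] by apply: contraNneq pq => w0E; rewrite qE w0E.
have xw : x \notin p :: w.
  move: px pw; elim: w (p) {uw qE w0n} => [|a w IHw] b bx /=.
    by rewrite inE eq_sym.
  case/andP => /and3P[_ _ ax] pw.
  by rewrite inE negb_or eq_sym bx (IHw a).
have pFw : path F p w by apply: sub_path pw => a b /and3P[].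
have [_ /(_ [:: x, p & w])] := treeF; case: w w0n xw pFw uw qE {pw} => //= b w _ xw pFw uw qE.
have cyc : ucycle F [:: x, p, b & w].
  apply/andP; split; last by rewrite cons_uniq xw; exact: uw.
  rewrite /= (adj_sym F x p) Fp /= rcons_path -qE Fq andbT.
  exact: pFw.
by move/(_ cyc).
Qed.

(** A simple path to [x] avoiding [p] would arrive from a second parent. *)
Lemma parent_separates x p :
  F p x -> reaches x p -> ~~ connect (avoiding p) r x.
Proof.
move=> Fp rp; apply/negP => /connectP[w0 pw0 xE]; move: xE.
case/shortenP: pw0 => w pw uw _ xE.
case/lastP: w pw uw xE => [_ _ xr|w z]; first by rewrite xr /= reaches_root in rp.
rewrite rcons_path last_rcons -rcons_cons rcons_uniq => /andP[pw /and3P[Fz zp _]] /andP[zw _] zx.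
move: zw Fz; rewrite -zx => xw Fx.
have pFw : path F r w by apply: sub_path pw => a b /and3P[].
by move: zp; rewrite (parent_uniq Fx (reaches_path pFw xw) Fp rp) eqxx.
Qed.

Lemma reaches_avoiding p x y :
  connect (avoiding p) r y -> ~~ connect (avoiding p) r x -> reaches x y.
Proof.
case/connectP => w pw -> nx; apply: reaches_path.
  by apply: sub_path pw => a b /and3P[].
by apply: contra nx; exact: path_connect.
Qed.

(** The number of vertices outside the subtree of [x] stands in for the distance from the root; it
    grows strictly towards proper descendants. *)
Definition depth (x : T) : nat := #|[set y | reaches x y]%SET|.

Lemma depth_parent x p : F p x -> reaches x p -> (depth p < depth x)%N.
Proof.
move=> Fp rp; apply: proper_card; apply/properP; split; last first.
  by exists p; rewrite !inE // /reaches eqxx.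
apply/fintype.subsetP => y; rewrite !inE => /andP[_ ry].
exact: reaches_avoiding ry (parent_separates Fp rp).
Qed.

Lemma depth_descendant x y : x != y -> ~~ reaches x y -> (depth x < depth y)%N.
Proof.
move=> xy nxy; apply: proper_card; apply/properP; split; last first.
  exists x; rewrite !inE; last by rewrite /reaches eqxx.
  by have := reaches_total xy; rewrite (negPf nxy).
apply/fintype.subsetP => z; rewrite !inE => /andP[_ rz].
by apply: reaches_avoiding rz _; move: nxy; rewrite /reaches eq_sym xy.
Qed.

Variable C : pred T.
Hypothesis connC : forall t t', t \in C -> t' \in C ->
  connect [rel x y | [&& F x y, x \in C & y \in C]] t t'.

(** A walk inside [C] can leave the subtree of [a] only from [a] to its parent. *)
Lemma subtree_boundary a b c : b \in C -> c \in C -> ~~ reaches a c -> reaches a b ->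
  a \in C /\ exists d, [/\ d \in C, F d a & reaches a d].
Proof.
move=> bC cC nc rb; have /connectP[w pw bE] := connC cC bC.
elim: w c {cC} nc pw bE => [|d w IHw] c nc /=; first by move=> _ bE; rewrite -bE rb in nc.
case/andP => /and3P[Fcd cC dC] pw bE.
have [rd|nd] := boolP (reaches a d); last exact: IHw nd pw bE.
have ca : c = a.
  apply/eqP; apply: contraNT nc => ca; case/andP: rd => da rd.
  rewrite /reaches ca (connect_trans rd) //; apply: connect1.
  by rewrite /avoiding /= (adj_sym F) Fcd da ca.
by rewrite -ca in rd *; split => //; exists d; rewrite (adj_sym F).
Qed.

(** Take a node of [C] of least depth: if [C] left its subtree, it would contain the parent, which
    is less deep. *)
Lemma subtree_top t : t \in C -> exists2 x, x \in C &
  forall y, y \in C -> ~~ reaches x y.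
Proof.
move=> tC; case: (@arg_minnP T t (fun x => x \in C) depth tC) => x xC minx.
exists x => // y yC; apply/negP => rxy.
have nxx : ~~ reaches x x by rewrite /reaches eqxx.
have [_ [d [dC Fd rd]]] := subtree_boundary yC xC nxx rxy.
by have := minx d dC; rewrite leqNgt depth_parent.
Qed.

End RootedTree.

(* A vertex whose bags have the deepest topmost node has its whole
   neighbourhood in the bag of that node. *)
Lemma min_degree_not_treewidth_le (V : finType) (G : graph V) (W : {set V}) (w : V) k :
  w \in W -> (forall v, v \in W -> (k < #|[set u in W | G v u]|)%N) ->
  ~ treewidth_le G k.
Proof.
move=> wW deg [T [F [B [[treeF cover edge conn] small]]]].
have [r _] := cover w.
have connB v : forall t t', t \in [pred t | v \in B t] -> t' \in [pred t | v \in B t] ->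
    connect [rel x y | [&& F x y, x \in [pred t | v \in B t] &
      y \in [pred t | v \in B t]]] t t'.
  by move=> t t'; exact: conn.
pose top (p : V * T) := [&& p.1 \in W, p.1 \in B p.2 &
  [forall y, (p.1 \in B y) ==> ~~ reaches F r p.2 y]].
have has_top v : v \in W -> exists x, top (v, x).
  move=> vW; have [t vt] := cover v.
  have [x vx topx] := subtree_top treeF r (connB v) vt.
  exists x; rewrite /top /= vW [_ \in B x]vx /=; apply/forallP => y; apply/implyP.
  exact: topx.
have [x0 top0] := has_top w wW.
case: (@arg_maxnP _ (w, x0) top (fun p => depth F r p.2) top0) => -[v x].
case/and3P => /= vW vx /forallP topx maxx.
(* Otherwise a common bag of [u] and [v] lies below [x], while the topmost bag of [u], being no
   deeper than [x], does not; the bags of [u] are connected and would have to include that of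
   [x]. *)
have nbr u : u \in W -> G v u -> u \in B x.
  move=> uW Gvu; apply/negPn/negP => ux.
  have [t0 /andP[vt0 ut0]] := edge v u Gvu.
  have nt0 : ~~ reaches F r x t0 by have /implyP := topx t0; exact.
  have [y /and3P[/= _ uy /forallP topy]] := has_top u uW.
  have := maxx (u, y); rewrite /top /= uW uy /= => /(_ (introT forallP topy)).
  rewrite leqNgt => /negP; apply; apply: depth_descendant => //.
    by apply: contraNneq ux => ->.
  apply/negP => rxy.
  by have [xC _] := subtree_boundary (connB u) uy ut0 nt0 rxy; move: ux; rewrite [_ \in B x]xC.
(* Beside [v] itself the bag has room for only [k] neighbours. *)
have := leq_trans (deg v vW) (_ : #|[set u in W | G v u]| <= #|B x :\ v|)%N.
rewrite ltnNge => H; have /negP[] : ~~ (#|B x :\ v| <= k)%N.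
  rewrite H //; apply: subset_leq_card; apply/fintype.subsetP => u.
  rewrite !inE => /andP[uW Gvu]; rewrite nbr // andbT.
  by apply: contraTneq Gvu => ->; rewrite (adj_irr G).
by have := small x; rewrite (cardsD1 v) vx.
Qed.

(** * Bounds from exchanging two edges *)

Lemma swap_lower_bound (R : realType) (F : task) :
  (forall n, (60 < n)%N -> exists (I : instance n) (x y : 'I_(n %/ 12) -> 'I_n),
     F n I /\ forall i j : 'I_(n %/ 12), (i < j)%N ->
     exists (uq : uniq [:: x i; y i; x j; y j]) (h1 : inst_graph I (x i) (y i))
       (h2 : inst_graph I (x j) (y j)) (h3 : ~~ inst_graph I (x i) (y j))
       (h4 : ~~ inst_graph I (x j) (y i)),
     connected_graph (swap_graph uq h1 h2 h3 h4) /\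
     forall J : instance n, inst_graph J = swap_graph uq h1 h2 h3 h4 -> ~ F n J) ->
  requires_log_proof_size R F.
Proof.
move=> H; apply: crossing_lower_bound => n /H[I [x [y [FI cross]]]].
exists I, x, y; split => // i j /cross[uq [h1 [h2 [h3 [h4 [conn nF]]]]]].
exists (swap_instance conn); split; first exact: nF.
by move=> l lx ly v; exact: map_swap_nbr.
Qed.

Lemma connect_interval n (e : rel 'I_n) (i j : 'I_n) : (i <= j)%N ->
  (forall x y : 'I_n, (i <= x)%N -> (y <= j)%N -> y = x.+1 :> nat -> e x y) ->
  connect e i j.
Proof.
move=> ij; have [d jE] : exists d, j = (i + d)%N :> nat.
  by exists (j - i)%N; rewrite subnKC.
elim: d j jE {ij} => [|d IHd] j jE step.
  by rewrite (_ : j = i) ?connect0 //; apply: val_inj; rewrite /= jE addn0.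
have ltd : (i + d < n)%N by apply: leq_trans (ltn_ord j); rewrite jE addnS.
apply: connect_trans (_ : connect e i (Ordinal ltd)) _.
  by apply: IHd => // x y ix yd; apply: step => //; rewrite jE addnS ltnW.
by apply: connect1; apply: step; rewrite //= ?jE ?leq_addr // addnS.
Qed.

(** * The path as a tree *)

Section Path.
Variable m : nat.

Definition path_rel : rel 'I_m.+1 := [rel x y : 'I_m.+1 | (x.+1 == y :> nat) || (y.+1 == x :> nat)].

Lemma path_rel_sym : symmetric path_rel.
Proof. by move=> x y; rewrite /path_rel /= orbC. Qed.

Lemma path_rel_irr : irreflexive path_rel.
Proof. by move=> x; rewrite /path_rel /= orbb; lia. Qed.

Definition path_graph : graph 'I_m.+1 := Graph path_rel_sym path_rel_irr.

Lemma path_graph_tree : is_tree path_graph.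
Proof.
have sym : connect_sym path_graph by exact: sym_connect_sym path_rel_sym.
split=> [x y|c].
  have up (a b : 'I_m.+1) : (a <= b)%N -> connect path_graph a b.
    by move=> ab; apply: connect_interval => // u v _ _ vE; rewrite /= /path_rel /= vE eqxx.
  by have [xy|/ltnW yx] := leqP x y; [exact: up|rewrite sym; exact: up].
case/andP => cyc uc; case: c cyc uc => // x0 c0; set c := x0 :: c0 => cyc uc.
have x0c : x0 \in c by rewrite inE eqxx.
(* In a cycle of length at least three the largest vertex would have two distinct neighbours, both
   equal to its predecessor. *)
case: (@arg_maxnP _ x0 (fun x => x \in c) val x0c) => x xc maxx.
have [k c' rotE] := rot_to xc.
have := cyc; rewrite -(rot_cycle k) rotE; have := uc; rewrite -(rot_uniq k) rotE.
have szE : size c = (size c').+1 by rewrite -(size_rot k) rotE.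
have memc z : z \in c' -> (z <= x)%N.
  by move=> zc; apply: maxx; rewrite -(mem_rot k) rotE inE zc orbT.
rewrite szE; case: c' {rotE szE} memc => // y c' memc.
rewrite /= rcons_path => /and3P[_ yc' _] /and3P[Fxy _ Fzx].
case: c' memc yc' Fzx => // z c' memc yc' Fzx; exfalso.
have lc : last z c' \in z :: c' by exact: mem_last.
have := memc y; rewrite inE eqxx => /(_ isT).
have := memc (last z c'); rewrite inE lc orbT => /(_ isT).
move: Fxy Fzx; rewrite /path_rel /= => Fxy Fzx lx yx.
have yE : y = last z c' by apply: val_inj => /=; lia.
by rewrite yE lc in yc'.
Qed.

End Path.

(** * Fans, and the wheel in an exchanged fan *)

Section Fan.
Variable m : nat.
Local Notation V := 'I_m.+1.

Definition fan_rel : rel V := [rel x y : V | (x != y :> nat) &&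
  [|| x == 0%N :> nat, y == 0%N :> nat, x.+1 == y :> nat | y.+1 == x :> nat]].

Lemma fan_rel_sym : symmetric fan_rel.
Proof. by move=> x y; rewrite /fan_rel /=; lia. Qed.

Lemma fan_rel_irr : irreflexive fan_rel.
Proof. by move=> x; rewrite /fan_rel /= eqxx. Qed.

Definition fan : graph V := Graph fan_rel_sym fan_rel_irr.

Lemma hub_connected (G : graph V) : (forall x : V, x != 0%N :> nat -> G ord0 x) ->
  connected_graph G.
Proof.
move=> hub; have hubc x : connect G ord0 x.
  have [x0|x0] := eqVneq (x : nat) 0%N; last exact: connect1 (hub x x0).
  by rewrite (_ : x = ord0) ?connect0 //; apply: val_inj.
move=> x y; apply: connect_trans (hubc y).
by rewrite (sym_connect_sym (adj_sym G)).
Qed.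

Lemma fan_connected : connected_graph fan.
Proof. by apply: hub_connected => x x0; rewrite /= /fan_rel /= eq_sym x0. Qed.

Lemma fan_treewidth : treewidth_le fan 2.
Proof.
(* The triangles of the fan, strung along a path. *)
pose B (t : V) : {set V} := 
    [set x : V | [|| x == 0 :> nat, x == t :> nat | x == t.+1 :> nat]%N]%SET.
exists V, (path_graph m), B; split; last first.
  (* For the last [t], [inord t.+1] takes its default value [ord0], which does no harm as the bag
     contains the hub anyway. *)
  move=> t; apply: leq_trans (_ : #|[set ord0; t; inord t.+1 : V]%SET| <= 3)%N.
    apply: subset_leq_card; apply/fintype.subsetP => x; rewrite !inE -!val_eqE /=.
    case/or3P => [->|->|/eqP xE] //; first by rewrite orbT.
    by rewrite -xE inordK // eqxx !orbT.
  by rewrite -finset.setUA cardsU1 cards2; do 2 case: (_ \notin _) || case: (_ != _).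
split.
- exact: path_graph_tree.
- by move=> v; exists v; rewrite inE eqxx orbT.
- move=> u v; rewrite /= /fan_rel /= => uv.
  have [ltuv|leuv] := ltnP u v; [exists (if u == 0%N :> nat then v else u) |
    exists (if v == 0%N :> nat then u else v)]; rewrite !inE.
    by have [u0|u0] := eqVneq (u : nat) 0%N; lia.
  by have [v0|v0] := eqVneq (v : nat) 0%N; lia.
move=> v t t'; rewrite !inE => vt vt'.
have sym : connect_sym [rel x y | [&& path_graph m x y, v \in B x & v \in B y]].
  apply: sym_connect_sym => x y; rewrite /= path_rel_sym.
  by case: (v \in B x); case: (v \in B y); rewrite ?andbF.
have up (a b : V) : (a <= b)%N -> v \in B a -> v \in B b ->
    connect [rel x y | [&& path_graph m x y, v \in B x & v \in B y]] a b.
  rewrite !inE => ab va vb; apply: connect_interval => // x y ax yb yE.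
  by rewrite /= /path_rel /= !inE yE eqxx /=; lia.
by have [tt'|/ltnW t't] := leqP t t'; [|rewrite sym]; apply: up; rewrite // inE.
Qed.

Lemma mem_edges (T : finType) (G : graph T) (e : {set T}) :
  reflect (exists x y, G x y /\ e = [set x; y]%SET) (e \in edges G).
Proof.
apply: (iffP imsetP) => [[[x y]]|[x [y [Gxy ->]]]].
  by rewrite inE => Gxy ->; exists x, y.
by exists (x, y); rewrite ?inE.
Qed.

(** The fan grows by one vertex through a series composition with the next path edge, followed by a
    parallel composition with the next spoke. *)
Lemma fan_sp k : (0 < k <= m)%N ->
  sp_graph [set x : V | (x <= k)%N]%SET
    [set e in edges fan | e \subset [set x : V | (x <= k)%N]%SET]%SET ord0 (inord k).
Proof.
elim: k => // k IHk /andP[_ km]; case: k IHk km => [_ m1|k IHk km].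
  have -> : [set x : V | (x <= 1)%N]%SET = [set ord0; inord 1]%SET.
    by apply/setP => x; rewrite !inE -!val_eqE /= inordK //; lia.
  have -> : [set e in edges fan | e \subset [set ord0; inord 1]%SET]%SET =
      [set [set ord0; inord 1]]%SET.
    apply/setP => e; rewrite !inE; apply/andP/eqP => [[/mem_edges[x [y [Gxy ->]]] sub]|->].
      have := fintype.subsetP sub x; have := fintype.subsetP sub y.
      rewrite !inE !eqxx !orbT => /(_ isT) hy /(_ isT) hx.
      move: hx hy Gxy => /orP[]/eqP-> /orP[]/eqP->; rewrite ?(adj_irr fan) //.
      by rewrite finset.setUC.
    split=> //; apply/mem_edges; exists ord0, (inord 1); split => //.
    by rewrite /= /fan_rel /= inordK.
  by apply: SpEdge; rewrite -val_eqE /= inordK.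
pose U := [set x : V | (x <= k.+1)%N]%SET.
pose E := [set e in edges fan | e \subset U]%SET.
have {}IHk : sp_graph U E ord0 (inord k.+1) by apply: IHk; exact: ltnW km.
pose c : V := inord k.+1; pose d : V := inord k.+2.
have cE : c = k.+1 :> nat by rewrite inordK // ltnS ltnW.
have dE : d = k.+2 :> nat by rewrite inordK.
have UE : [set x : V | (x <= k.+2)%N]%SET = ((U :|: [set c; d]) :|: [set ord0; d])%SET.
  by apply/setP => x; rewrite !inE -!val_eqE /= cE dE; lia.
have EE : [set e in edges fan | e \subset [set x : V | (x <= k.+2)%N]%SET]%SET =
    ((E :|: [set [set c; d]]) :|: [set [set ord0; d]])%SET.
  have ordered x y : fan x y -> (x < y <= k.+2)%N ->
      [set x; y]%SET \in ((E :|: [set [set c; d]]) :|: [set [set ord0; d]])%SET.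
    move=> Gxy /andP[xy yk]; rewrite !inE.
    have [yk1|yk1] := leqP y k.+1.
      apply/orP; left; apply/orP; left; apply/andP; split.
        by apply/mem_edges; exists x, y.
      apply/fintype.subsetP => z /set2P[]->; rewrite inE //.
      exact: leq_trans (ltnW xy) yk1.
    have yd : y = d by apply: val_inj; rewrite /= dE; lia.
    move: Gxy; rewrite /= /fan_rel /= => Gxy.
    have [x0|x0] := eqVneq (x : nat) 0%N.
      by rewrite (_ : x = ord0) ?yd ?eqxx ?orbT //; apply: val_inj.
    rewrite (_ : x = c) ?yd ?eqxx ?orbT //; apply: val_inj.
    by rewrite /= cE; move: dE Gxy; rewrite yd; lia.
  apply/setP => e; apply/idP/idP.
    rewrite inE => /andP[/mem_edges[x [y [Gxy ->]]] sub].
    have hx : (x <= k.+2)%N by have := fintype.subsetP sub x (set21 x y); rewrite inE.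
    have hy : (y <= k.+2)%N by have := fintype.subsetP sub y (set22 x y); rewrite inE.
    have [xy|yx|/val_inj xy] := ltngtP x y; first by apply: ordered; rewrite // xy.
      by rewrite (finset.setUC [set x]%SET); apply: ordered; rewrite ?yx // (adj_sym fan).
    by move: Gxy; rewrite xy (adj_irr fan).
  rewrite !inE => /orP[/orP[/andP[-> sub]|/eqP->]|/eqP->] /=.
  - apply: (fintype.subset_trans sub); apply/fintype.subsetP => x.
    by rewrite !inE; exact: leqW.
  - apply/andP; split.
      apply/mem_edges; exists c, d; split => //.
      by rewrite /= /fan_rel /= cE dE; lia.
    by apply/fintype.subsetP => x /set2P[]->; rewrite inE ?cE ?dE.
  apply/andP; split.
    apply/mem_edges; exists ord0, d; split => //.
    by rewrite /= /fan_rel /= dE; lia.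
  by apply/fintype.subsetP => x /set2P[]->; rewrite inE ?dE.
rewrite EE UE; apply: SpParallel.
- apply: SpSeries IHk _ _.
    by apply: SpEdge; rewrite -val_eqE /= cE dE; lia.
  by apply/setP => x; rewrite !inE -!val_eqE /= cE dE; lia.
- by apply: SpEdge; rewrite -val_eqE /= dE.
- by apply/setP => x; rewrite !inE -!val_eqE /= cE dE; lia.
apply/setP => e; rewrite !inE; apply/negP => /andP[+ /eqP eE].
rewrite eE => /orP[/andP[_ /fintype.subsetP/(_ d)]|/eqP].
  by rewrite !inE eqxx orbT dE ltnn => /(_ isT).
move=> /setP/(_ ord0); rewrite !inE eqxx -!val_eqE /= cE dE.
by lia.
Qed.

Lemma fan_series_parallel : (0 < m)%N -> series_parallel fan.
Proof.
move=> m0; exists ord0, (inord m).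
have := @fan_sp m; rewrite m0 leqnn => /(_ isT).
have -> : [set x : V | (x <= m)%N]%SET = finset.setT.
  by apply/setP => x; rewrite !inE -ltnS ltn_ord.
congr sp_graph; apply/setP => e; rewrite inE.
by rewrite (_ : e \subset _) ?andbT //; apply/fintype.subsetP => x; rewrite inE.
Qed.

Definition fan_instance : instance m.+1 :=
  Instance fan_connected (inst_ports := fun v => enum (fan v)) (fun v => enum_uniq _)
    (fun v u => mem_enum (fan v) u).

Variables i j : nat.
Hypotheses (i0 : (0 < i)%N) (ij : (i.+2 < j)%N) (jm : (j < m)%N).
Let a : V := inord i.
Let b : V := inord i.+1.
Let c : V := inord j.
Let d : V := inord j.+1.
Let aE : a = i :> nat. Proof. by rewrite inordK //; lia. Qed.
Let bE : b = i.+1 :> nat. Proof. by rewrite inordK //; lia. Qed.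
Let cE : c = j :> nat. Proof. by rewrite inordK //; lia. Qed.
Let dE : d = j.+1 :> nat. Proof. by rewrite inordK //; lia. Qed.

Lemma fan_swap_uniq : uniq [:: a; b; c; d].
Proof. by rewrite /= !inE -!val_eqE /= aE bE cE dE; lia. Qed.

Lemma fan_ab : fan a b. Proof. by rewrite /= /fan_rel /= aE bE; lia. Qed.
Lemma fan_cd : fan c d. Proof. by rewrite /= /fan_rel /= cE dE; lia. Qed.
Lemma fan_ad : ~~ fan a d. Proof. by rewrite /= /fan_rel /= aE dE; lia. Qed.
Lemma fan_cb : ~~ fan c b. Proof. by rewrite /= /fan_rel /= cE bE; lia. Qed.

Definition swapped_fan : graph V := swap_graph fan_swap_uniq fan_ab fan_cd fan_ad fan_cb.

Lemma swapped_fan_kept (x y : V) : fan x y ->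
  (x == 0%N :> nat) || (b <= x)%N && (y <= c)%N && (x < y)%N -> swapped_fan x y.
Proof.
move=> Gxy h; apply: swap_graph_kept => //; rewrite !inE -!val_eqE /= aE bE cE dE;
  by move: Gxy h; rewrite /= /fan_rel /= bE cE; lia.
Qed.

Lemma swapped_fan_hub (x : V) : x != 0%N :> nat -> swapped_fan ord0 x.
Proof.
by move=> x0; apply: swapped_fan_kept; rewrite //= /fan_rel /= eq_sym x0.
Qed.

Lemma swapped_fan_connected : connected_graph swapped_fan.
Proof. exact: hub_connected swapped_fan_hub. Qed.

(** The new edge [c b] closes the path from [b] to [c] into a cycle, the rim around the hub 0. *)
Definition wheel : {set V} := [set x : V | (x == 0%N :> nat) || (b <= x <= c)%N]%SET.

Lemma swapped_fan_wheel v : v \in wheel ->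
  (2 < #|[set u in wheel | swapped_fan v u]%SET|)%N.
Proof.
have sym := adj_sym swapped_fan.
have succ (x y : V) : (b <= x)%N -> (y <= c)%N -> y = x.+1 :> nat -> swapped_fan x y.
  move=> bx yc yE; apply: swapped_fan_kept; first by rewrite /= /fan_rel /= yE; lia.
  by rewrite bx yc yE ltnSn orbT.
have cb : swapped_fan c b by exact: swap_graph_cb.
have n0 (x : V) : (b <= x)%N -> swapped_fan x ord0.
  by move=> bx; rewrite sym swapped_fan_hub //; move: bx; rewrite bE; lia.
have W0 : ord0 \in wheel by rewrite inE.
have Wb : b \in wheel by rewrite inE leqnn bE cE; lia.
have Wc : c \in wheel by rewrite inE leqnn bE cE; lia.
have nbrI (x u : V) : u \in wheel -> swapped_fan x u ->
    u \in [set u in wheel | swapped_fan x u]%SET.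
  by move=> uW xu; rewrite inE uW.
rewrite inE => vW; have [v0|v0] := eqVneq (v : nat) 0%N.
  have -> : v = ord0 by exact: val_inj.
  (* A third rim vertex strictly between [b] and [c], available since [i.+2 < j]. *)
  pose b' : V := inord i.+2.
  have b'E : b' = i.+2 :> nat by rewrite inordK //; lia.
  have Wb' : b' \in wheel by rewrite inE b'E bE cE; lia.
  have dist (x y : V) : x != y :> nat -> x != y by rewrite -val_eqE.
  apply/card_gt2P; exists b, b', c; split.
    by split; apply: nbrI; rewrite // swapped_fan_hub // ?bE ?b'E ?cE //; lia.
  by split; apply: dist; rewrite ?bE ?b'E ?cE; lia.
move: vW; rewrite (negPf v0) /= => /andP[bv vc].
(* The neighbours of [v] along the rim, which wraps around at [b] and [c]. *)
pose p : V := if v == b then c else inord v.-1.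
pose q : V := if v == c then b else inord v.+1.
have vm : (v < m)%N by apply: leq_ltn_trans vc _; rewrite cE.
have [vp pW pE] : [/\ swapped_fan v p, p \in wheel & (p == c) && (v == b) || (p.+1 == v :> nat)].
  rewrite /p; have [vb|vb] := eqVneq v b; first by rewrite vb eqxx; split; rewrite // sym.
  have bv' : (b < v)%N by rewrite ltn_neqAle bv eq_sym -val_eqE andbT in vb *.
  have pE : (inord v.-1 : V) = v.-1 :> nat by rewrite inordK //; lia.
  rewrite !inE pE; split; [|lia|lia].
  by rewrite sym; apply: succ; rewrite ?pE //; lia.
have [vq qW qE] : [/\ swapped_fan v q, q \in wheel & (q == b) && (v == c) || (q == v.+1 :> nat)].
  rewrite /q; have [vcE|vcE] := eqVneq v c; first by rewrite vcE eqxx; split.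
  have vc' : (v < c)%N by rewrite ltn_neqAle vc -val_eqE andbT in vcE *.
  have qE : (inord v.+1 : V) = v.+1 :> nat by rewrite inordK //; lia.
  rewrite !inE qE; split; [|lia|lia].
  by apply: succ; rewrite ?qE //; lia.
apply/card_gt2P; exists ord0, p, q; split.
  by split; apply: nbrI; rewrite // n0.
move: pE qE pW qW; rewrite !inE -!val_eqE /= bE cE => pE qE pW qW.
by split; move: pE qE pW qW bv vc v0; rewrite ?bE ?cE; lia.
Qed.

Lemma swapped_fan_not_series_parallel : ~ series_parallel swapped_fan.
Proof.
apply: (@min_degree_not_series_parallel _ _ wheel ord0); first by rewrite inE.
exact: swapped_fan_wheel.
Qed.

Lemma swapped_fan_not_treewidth2 : ~ treewidth_le swapped_fan 2.
Proof.
apply: (@min_degree_not_treewidth_le _ _ wheel ord0); first by rewrite inE.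
exact: swapped_fan_wheel.
Qed.

End Fan.

Lemma fan_lower_bound (R : realType) (P : forall V : finType, graph V -> Prop) :
  (forall m, (0 < m)%N -> P _ (fan m)) ->
  (forall m i j (i0 : (0 < i)%N) (ij : (i.+2 < j)%N) (jm : (j < m)%N),
     ~ P _ (swapped_fan i0 ij jm)) ->
  requires_log_proof_size R (fun n I => P _ (inst_graph I)).
Proof.
move=> yes no; apply: swap_lower_bound => -[//|m] n60.
(* Steps of three starting at 1 keep the candidates off the hub and leave at least three vertices on
   the split-off cycle. *)
exists (fan_instance m), (fun g => inord (3 * g).+1), (fun g => inord (3 * g).+2).
split=> [|g h gh]; first by apply: yes; lia.
have i0 : (0 < (3 * g).+1)%N by [].
have ij : ((3 * g).+1.+2 < (3 * h).+1)%N by lia.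
have jm : ((3 * h).+1 < m)%N by have := ltn_ord h; lia.
exists (fan_swap_uniq i0 ij jm), (fan_ab i0 ij jm), (fan_cd i0 ij jm).
exists (fan_ad i0 ij jm), (fan_cb i0 ij jm); split.
  exact: swapped_fan_connected.
by move=> J ->; exact: no.
Qed.

(** The Hamiltonian path gives the order along the parabola. *)
Lemma path_outerplanar_planar (R : realType) (V : finType) (G : graph V) :
  path_outerplanar G -> planar R G.
Proof.
move=> [P [uP allP _ nc]]; exists (parabola R (fun v => index v P)).
apply: crossing_free_parabola => [u v e|u v u' v' Guv Guv'].
  by rewrite -(nth_index u (allP u)) e (nth_index u (allP v)).
exact: nc.
Qed.

(** * Ladders, and K_{3,3} in an exchanged ladder *)

Section Ladder.
Variable m : nat.
Local Notation V := 'I_m.+1.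

(* The path [0, ..., m] with all chords [x, m - x]: a ladder whose rungs are
   nested along the path. *)
Definition ladder_rel : rel V := [rel x y : V | (x != y :> nat) &&
  [|| x.+1 == y :> nat, y.+1 == x :> nat | x + y == m :> nat]%N].

Lemma ladder_rel_sym : symmetric ladder_rel.
Proof. by move=> x y; rewrite /ladder_rel /=; lia. Qed.

Lemma ladder_rel_irr : irreflexive ladder_rel.
Proof. by move=> x; rewrite /ladder_rel /= eqxx. Qed.

Definition ladder : graph V := Graph ladder_rel_sym ladder_rel_irr.

Lemma path_connected (G : graph V) : (forall x y : V, y = x.+1 :> nat -> G x y) ->
  connected_graph G.
Proof.
move=> step.
have up (x y : V) : (x <= y)%N -> connect G x y.
  by move=> xy; apply: connect_interval => // u v _ _; exact: step.
move=> x y; have [xy|/ltnW yx] := leqP x y; first exact: up.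
by rewrite (sym_connect_sym (adj_sym G)); exact: up.
Qed.

Lemma ladder_connected : connected_graph ladder.
Proof. by apply: path_connected => x y yE; rewrite /= /ladder_rel /= yE; lia. Qed.

Lemma ladder_noncrossing (u v u' v' : V) : ladder u v -> ladder u' v' ->
  ~ [/\ (u < u')%N, (u' < v)%N & (v < v')%N].
Proof. by rewrite /= /ladder_rel /= => h h' [? ? ?]; lia. Qed.

Lemma ladder_path_outerplanar : path_outerplanar ladder.
Proof.
exists (enum V); split.
- exact: enum_uniq.
- by move=> v; rewrite mem_enum.
- have : sorted ltn (map val (enum V)) by rewrite val_enum_ord iota_ltn_sorted.
  have : forall x y : V, x \in enum V -> y \in enum V -> y = x.+1 :> nat -> ladder x y.
    by move=> x y _ _ yE; rewrite /= /ladder_rel /= yE; lia.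
  move=> step _; apply/(sortedP ord0) => k; rewrite size_enum_ord => km.
  by apply: step; rewrite ?mem_enum // !nth_enum_ord // ltnW.
by move=> u v u' v' Guv Guv'; rewrite !index_enum_ord; exact: ladder_noncrossing.
Qed.

Variable R : realType.

(** The ports follow the drawing on the parabola, so the same instance serves the embedding task and
    the pure graph families. *)
Definition ladder_instance : instance m.+1 :=
  Instance ladder_connected
    (clockwise_nbrs_uniq R ladder (@nat_of_ord m.+1))
    (mem_clockwise_nbrs R ladder (@nat_of_ord m.+1)).

Variables i k : nat.
Hypotheses (i0 : (0 < i)%N) (ik : (i.+2 < k)%N) (km : (k.*2.+1 < m)%N).
Let a : V := inord i.
Let b : V := inord (m - i).
Let c : V := inord k.
Let d : V := inord (m - k).
Let e : V := inord i.+1.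
Let g : V := inord (m - i.+1).
Let aE : a = i :> nat. Proof. by rewrite inordK //; lia. Qed.
Let bE : b = (m - i)%N :> nat. Proof. by rewrite inordK //; lia. Qed.
Let cE : c = k :> nat. Proof. by rewrite inordK //; lia. Qed.
Let dE : d = (m - k)%N :> nat. Proof. by rewrite inordK //; lia. Qed.
Let eE : e = i.+1 :> nat. Proof. by rewrite inordK //; lia. Qed.
Let gE : g = (m - i.+1)%N :> nat. Proof. by rewrite inordK //; lia. Qed.

Lemma ladder_swap_uniq : uniq [:: a; b; c; d].
Proof. by rewrite /= !inE -!val_eqE /= aE bE cE dE; lia. Qed.

Lemma ladder_ab : ladder a b. Proof. by rewrite /= /ladder_rel /= aE bE; lia. Qed.
Lemma ladder_cd : ladder c d. Proof. by rewrite /= /ladder_rel /= cE dE; lia. Qed.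
Lemma ladder_ad : ~~ ladder a d. Proof. by rewrite /= /ladder_rel /= aE dE; lia. Qed.
Lemma ladder_cb : ~~ ladder c b. Proof. by rewrite /= /ladder_rel /= cE bE; lia. Qed.

Definition swapped_ladder : graph V :=
  swap_graph ladder_swap_uniq ladder_ab ladder_cd ladder_ad ladder_cb.

Lemma swapped_ladder_step (x y : V) : y = x.+1 :> nat -> swapped_ladder x y.
Proof.
move=> yE; apply: swap_graph_kept; first by rewrite /= /ladder_rel /= yE; lia.
  by rewrite !inE -!val_eqE /= aE bE cE dE yE; lia.
by rewrite !inE -!val_eqE /= aE bE cE dE yE; lia.
Qed.

Lemma swapped_ladder_rung (x y : V) : (x + y = m)%N -> x != i :> nat ->
  x != k :> nat -> (x < i.+2)%N -> swapped_ladder x y.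
Proof.
move=> xy xi xk xl; apply: swap_graph_kept; first by rewrite /= /ladder_rel /=; lia.
  by rewrite !inE -!val_eqE /= aE bE cE dE; lia.
by rewrite !inE -!val_eqE /= aE bE cE dE; lia.
Qed.

Lemma swapped_ladder_connected : connected_graph swapped_ladder.
Proof. by apply: path_connected => x y; exact: swapped_ladder_step. Qed.

Local Notation within S := [rel x y | [&& swapped_ladder x y, x \in S & y \in S]].

Lemma within_sym (S : pred V) : connect_sym (within S).
Proof.
apply: sym_connect_sym => x y.
rewrite -[LHS]/[&& swapped_ladder x y, x \in S & y \in S] (adj_sym swapped_ladder).
by congr (_ && _); rewrite andbC.
Qed.

Lemma within_up (S : pred V) (x y : V) : (x <= y)%N ->
  (forall z : V, (x <= z <= y)%N -> z \in S) -> connect (within S) x y.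
Proof.
move=> xy xyS; apply: connect_interval => // u v xu vy vE.
apply/and3P; split; [exact: swapped_ladder_step|apply: xyS|apply: xyS]; lia.
Qed.

Lemma within_edge (S : pred V) (x y : V) : swapped_ladder x y -> x \in S -> y \in S ->
  connect (within S) x y.
Proof. by move=> xy xS yS; apply: connect1; apply/and3P. Qed.

(* The nine paths join [a], [c], [g] to [e], [d], [b]. *)
Definition K33_regions (p q : nat) : pred V := nth pred0 (nth [::] [::
  [:: [pred x : V | i <= x <= i.+1]; [pred x : V | (x == i :> nat) || (x == m - k :> nat)];
      [pred x : V | (x <= i) || (m - i <= x)]];
  [:: [pred x : V | i.+1 <= x <= k]; [pred x : V | k <= x <= m - k];
      [pred x : V | (x == k :> nat) || (x == m - i :> nat)]];
  [:: [pred x : V | (x == i.+1 :> nat) || (x == m - i.+1 :> nat)];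
      [pred x : V | m - k <= x <= m - i.+1];
      [pred x : V | m - i.+1 <= x <= m - i]]]%N p) q.

(** The path closed by the rung from 0 to [m] is a cycle through [a], [e], [c], [d], [g], [b] in
    this order. Its chords [a d], [e g] and [c b] join opposite vertices of this hexagon, which
    makes a subdivision of K_{3,3}. *)
Lemma swapped_ladder_nonplanar : ~ planar R swapped_ladder.
Proof.
pose P p := nth ord0 [:: a; c; g] p; pose Q q := nth ord0 [:: e; d; b] q.
apply: (@K33_nonplanar R V swapped_ladder P Q K33_regions).
  have ad : swapped_ladder a d by exact: swap_graph_ad.
  have cb : swapped_ladder c b by exact: swap_graph_cb.
  have eg : swapped_ladder e g by apply: swapped_ladder_rung; rewrite ?eE ?gE; lia.
  have om : swapped_ladder ord0 ord_max by apply: swapped_ladder_rung => //=; lia.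
  move=> [|[|[|//]]] [|[|[|//]]] _ _; rewrite /P /Q /K33_regions /=;
    (split; first by rewrite !inE ?aE ?bE ?cE ?dE ?eE ?gE; lia).
  - by apply: within_up => [|z]; rewrite ?inE aE eE; lia.
  - by apply: within_edge; rewrite // !inE ?aE ?dE; lia.
  (* From [a] down to 0, over the outermost rung to [m], and down to [b]. *)
  - apply: (connect_trans (y := ord0)).
      by rewrite within_sym; apply: within_up => [|z] //; rewrite !inE aE; lia.
    apply: (connect_trans (y := ord_max)).
      by apply: within_edge; rewrite // !inE /=; lia.
    by rewrite within_sym; apply: within_up => [|z]; rewrite ?inE bE /=; lia.
  - by rewrite within_sym; apply: within_up => [|z]; rewrite ?inE cE eE; lia.
  - by apply: within_up => [|z]; rewrite ?inE cE dE; lia.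
  - by apply: within_edge; rewrite // !inE ?cE ?bE; lia.
  - by rewrite within_sym; apply: within_edge; rewrite // !inE ?eE ?gE; lia.
  - by rewrite within_sym; apply: within_up => [|z]; rewrite ?inE gE dE; lia.
  - by apply: within_up => [|z]; rewrite ?inE gE bE; lia.
move=> [|[|[|//]]] [|[|[|//]]] [|[|[|//]]] [|[|[|//]]] x _ _ _ _ // _ _;
  by rewrite /K33_regions /= !inE; lia.
Qed.

End Ladder.

(** All four planar tasks accept planar graphs only, so one nonplanar exchange refutes them all. *)
Lemma ladder_lower_bound (R : realType) (F : task) :
  (forall m, F m.+1 (ladder_instance m R)) ->
  (forall n (I : instance n), ~ planar R (inst_graph I) -> ~ F n I) ->
  requires_log_proof_size R F.
Proof.
move=> yes no; apply: swap_lower_bound => -[//|m] n60.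
(* Starting at 1 spares the outermost rung, and steps of three leave rung [i.+1] unchanged between
   two candidates; n %/ 12 of them fit into the first half of the path. *)
exists (ladder_instance m R), (fun g => inord (3 * g).+1), (fun g => inord (m - (3 * g).+1)).
split=> [|g h gh]; first exact: yes.
have i0 : (0 < (3 * g).+1)%N by [].
have ik : ((3 * g).+1.+2 < (3 * h).+1)%N by lia.
have km : ((3 * h).+1.*2.+1 < m)%N by have := ltn_ord h; lia.
exists (ladder_swap_uniq i0 ik km), (ladder_ab i0 ik km), (ladder_cd i0 ik km).
exists (ladder_ad i0 ik km), (ladder_cb i0 ik km); split.
  exact: swapped_ladder_connected.
by move=> J JE; apply: no; rewrite JE; exact: swapped_ladder_nonplanar.
Qed.

Theorem theorem1p7 (R : realType) :
  requires_log_proof_size R path_outerplanar_task /\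
  requires_log_proof_size R (outerplanar_task R) /\
  requires_log_proof_size R (planar_embedding_task R) /\
  requires_log_proof_size R (planar_task R) /\
  requires_log_proof_size R series_parallel_task /\
  requires_log_proof_size R treewidth2_task.
Proof.
have nc m := @ladder_noncrossing m.
split; [|split; [|split; [|split; [|split]]]].
- apply: ladder_lower_bound => [m|n I nP]; first exact: ladder_path_outerplanar.
  by move/(path_outerplanar_planar R)/nP.
- apply: ladder_lower_bound => [m|n I nP [D [cf _]]]; last by apply: nP; exists D.
  exact: outerplanar_parabola (@ord_inj m.+1) (@nc m).
- apply: ladder_lower_bound => [m|n I nP [D [cf _]]]; last by apply: nP; exists D.
  exact: planar_embedding_parabola (@ord_inj m.+1) (@nc m).
- apply: ladder_lower_bound => [m|//].
  by exists (parabola R (@nat_of_ord m.+1)); exact: crossing_free_parabola (@ord_inj m.+1) (@nc m).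
- exact: (fan_lower_bound R fan_series_parallel swapped_fan_not_series_parallel).
- apply: (fan_lower_bound R (P := fun V G => treewidth_le G 2)).
    by move=> m _; exact: fan_treewidth.
  exact: swapped_fan_not_treewidth2.
Qed.
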